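(* Let $1\le k<n$ be integers. For each $i \in \{0,1,\dots,\#S(k,n)-1\}$, the matching field $B(k,n)_i$ induced by the weight matrix $M_i$ gives rise to a toric degeneration of the Grassmannian $\mathrm{Gr}(k,n)$; that is, the Plücker forms $\det(X_I)$, $I\in\binom{[n]}{k}$, form a Khovanskii basis for the Plücker algebra with respect to the weight $M_i$.
   Context: Write $[n]=\{1,\dots,n\}$ and $\binom{[n]}{k}$ for the set of $k$-subsets of $[n]$. Sequence of triples. $S(k,n) = (S_0,S_1,\dots)$ is the finite sequence of triples $S_i=(p_i,\ell_i,q_i)\in\mathbb{Z}^3$ defined by $S_0=(k+1,k,n)$ and, given $(p_i,\ell_i,q_i)$: $S_{i+1} = (p_i,\ell_i,q_i+1)$ if $q_i<n$; $S_{i+1}=(p_i,\ell_i+1,k+1)$ if $q_i=n$ and $\ell_i<p_i-1$; $S_{i+1}=(p_i-1,1,k+1)$ if $p_i>2$, $\ell_i=p_i-1$ and $q_i=n$. The sequence terminates at the triple $(2,1,n)$. $\#S(k,n)$ denotes the number of triples, so the last index is $\#S(k,n)-1$. Weight matrices. $M_0=M_D\in\mathbb{R}^{k\times n}$ has $(M_D)_{1,j}=0$ and $(M_D)_{i,j}=(n-j)n^{i-2}$ for $2\le i\le k$, $j \in [n]$. For $i\ge1$, $M_i$ is obtained from $M_{i-1}$ by swapping the entries in positions $(\ell_i+1,p_i)$ and $(\ell_i+1,q_i)$. Matching fields. A weight matrix $M=(m_{i,j})\in\mathbb{R}^{k\times n}$ is generic if for each $J=\{j_1<\dots<j_k\}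 \in \binom{[n]}{k}$ the minimum of $\sum_{i=1}^k m_{i,j_{\sigma(i)}}$ over $\sigma\in S_k$ (symmetric group) is attained by a unique $\sigma_J$; the matching field induced by $M$ is $J\mapsto\sigma_J$. $B(k,n)_i$ is the matching field induced by $M_i$ (each $M_i$ is generic). Khovanskii bases. Let $X=(x_{i,j})$ be the $k\times n$ matrix of variables and $X_I$ its $k\times k$ submatrix with columns $I$. The Plücker algebra $A\subseteq\mathbb{C}[x_{i,j}]$ is the $\mathbb{C}$-subalgebra generated by all $\det(X_I)$. For a weight $w$ on the variables and a polynomial $f=\sum_u c_u x^u$, $w(f)=\min\{u\cdot w : c_u\ne0\}$ and $\mathrm{in}_w(f)=\sum_{u\cdot w=w(f)}c_u x^u$; $\mathrm{in}_w(A)=\mathbb{C}[\mathrm{in}_w(f):f\in A]$. Generators $f_1,\dots,f_s$ of $A$ form a Khovanskii basis with respect to $w$ if $\mathrm{in}_w(A)=\mathbb{C}[\mathrm{in}_w(f_1),\dots,\mathrm{in}_w(f_s)]$. A matching field induced by $M$ is said to give rise to a toric degeneration if the Plücker forms are a Khovanskii basis for the Plücker algebra with respect to $M$. *)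

(* Defs.v *)
From mathcomp Require Import all_boot all_order all_fingroup all_algebra.
From mathcomp Require Import zify.
From mathcomp Require Import reals complex mpoly.

Set Implicit Arguments.
Unset Strict Implicit.
Unset Printing Implicit Defensive.

Import Order.TTheory GRing.Theory Num.Theory.
Local Open Scope ring_scope.

(* Naturals written without cast ([triple], row and column positions of the   *)
(* weight functions) are 1-based; the indices of matrices and permutations    *)
(* are the 0-based ordinals 'I_k and 'I_n.                                    *)

Definition triple := (nat * nat * nat)%type.

Definition next_triple (k n : nat) (t : triple) : option triple :=
  let: (p, l, q) := t in
  if (q < n)%N then Some (p, l, q.+1)
  else if (q == n) && (l < p - 1)%N then Some (p, l.+1, k.+1)
  else if [&& (2 < p)%N, l == (p - 1)%N & q == n] then Some ((p - 1)%N, 1%N, k.+1)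
  else None.

Fixpoint run_triples (k n fuel : nat) (t : triple) : seq triple :=
  t :: if fuel is f.+1 then
         if next_triple k n t is Some t' then run_triples k n f t' else [::]
       else [::].

(* The fuel exceeds the number of steps; see [triples_last].                  *)
Definition triples (k n : nat) : seq triple :=
  run_triples k n (k * k * n) (k.+1, k, n).

Definition num_triples (k n : nat) : nat := size (triples k n).

Definition triple_at (k n i : nat) : triple := nth (0, 0, 0)%N (triples k n) i.

Lemma run_triples_last k n fuel x p l q :
    (0 < l < p)%N -> (k < q <= n)%N ->
    ((n - q) + (n - k) * ((p - 1 - l) + 'C(p - 1, 2)) <= fuel)%N ->
  last x (run_triples k n fuel (p, l, q)) = (2, 1, n)%N.
Proof.
elim: fuel x p l q => [|f IHf] x p l q lP qP.
  rewrite leqn0 addn_eq0 muln_eq0 addn_eq0 /= => /andP[qn].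
  case/orP=> [|/andP[pl]]; first by lia.
  case: p lP pl => [|[|[|p]]] lP pl; try lia; last first.
    by rewrite subn1 /= -leqn0 leqNgt bin_gt0.
  by move=> _; congr (_, _, _); lia.
move=> le_f /=.
case: ifP => [ltqn | /negbT geqn]; first by apply: IHf; lia.
have eqn : q = n by lia.
have ltkn : (k < n)%N by lia.
rewrite {geqn}eqn eqxx subnn add0n in le_f *.
case: ifP => [/= ltlp | /negbT /= gelp].
  apply: IHf; [lia | lia |].
  have -> : (n - k.+1 = (n - k).-1)%N by lia.
  have E : (p - 1 - l = (p - 1 - l.+1).+1)%N by lia.
  by move: le_f; rewrite E addSn mulnS; lia.
have -> : l = (p - 1)%N by lia.
case: ifP => [/and3P[lt2p _ _] | /negbT].
  apply: IHf; [lia | lia |].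
  have E : (p - 1 = (p - 3).+2)%N by lia.
  move: le_f; have -> : (p - 1 - l = 0)%N by lia.
  have -> : (p - 1 - 1 = (p - 3).+1)%N by lia.
  by rewrite E binS bin1 addnC addn0; nia.
rewrite !eqxx !andbT /= => le_p2.
by congr (_, _, _); lia.
Qed.

Lemma triples_last k n : (1 <= k < n)%N ->
  last (k.+1, k, n) (triples k n) = (2, 1, n)%N.
Proof.
move=> kP; apply: run_triples_last; [lia | lia |].
have : ('C(k, 2) <= k * k)%N.
  by rewrite bin2; have := half_leq (leq_mul (leqnn k) (leq_pred k)); lia.
have -> : (k.+1 - 1 - k = 0)%N by lia.
by rewrite subnn subn1 /=; nia.
Qed.

Definition diag_weight (R : nzRingType) (n : nat) (i j : nat) : R :=
  if (i == 1)%N then 0 else (n%:R - j%:R) * n%:R ^+ (i - 2).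

Definition swap_entries (R : Type) (r p q : nat) (M : nat -> nat -> R)
    (i j : nat) : R :=
  if i == r then M i (if j == p then q else if j == q then p else j) else M i j.

Fixpoint weight_fun (R : nzRingType) (k n i : nat) : nat -> nat -> R :=
  if i is i'.+1 then
    let: (p, l, q) := triple_at k n i in
    swap_entries l.+1 p q (weight_fun R k n i')
  else diag_weight R n.

Definition weight_mx (R : nzRingType) (k n i : nat) : 'M[R]_(k, n) :=
  \matrix_(a < k, b < n) weight_fun R k n i a.+1 b.+1.

Definition ksubset (k n : nat) := {J : {set 'I_n} | #|J| == k}.

(* [enum_val] enumerates J in increasing order.                               *)
Definition elt (k n : nat) (J : ksubset k n) (i : 'I_k) : 'I_n :=
  enum_val (cast_ord (esym (eqP (valP J))) i).

Definition matching_weight (R : realType) (k n : nat) (M : 'M[R]_(k, n))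
    (J : ksubset k n) (s : 'S_k) : R :=
  \sum_(i < k) M i (elt J (s i)).

Definition matching_field (k n : nat) := ksubset k n -> 'S_k.

Definition generic_weight (R : realType) (k n : nat) (M : 'M[R]_(k, n)) : Prop :=
  forall J : ksubset k n, exists s : 'S_k, forall t : 'S_k,
    t != s -> matching_weight M J s < matching_weight M J t.

Definition induced_matching_field (R : realType) (k n : nat)
    (M : 'M[R]_(k, n)) : matching_field k n :=
  fun J => [arg min_(s < 1%g) matching_weight M J s]%O.

Definition block_matching_field (R : realType) (k n i : nat) :
  matching_field k n := induced_matching_field (weight_mx R k n i).
Arguments block_matching_field : clear implicits.

Section Khovanskii.
Variables (R : realType) (N : nat).
Local Notation poly := {mpoly R[i][N]}.

Inductive subalgebra_gen (S : poly -> Prop) : poly -> Prop :=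
| SubalgGen f of S f : subalgebra_gen S f
| SubalgConst (c : R[i]) : subalgebra_gen S c%:MP
| SubalgAdd f g of subalgebra_gen S f & subalgebra_gen S g :
    subalgebra_gen S (f + g)
| SubalgMul f g of subalgebra_gen S f & subalgebra_gen S g :
    subalgebra_gen S (f * g).

Definition monomial_weight (w : 'rV[R]_N) (u : 'X_{1..N}) : R :=
  \sum_(v < N) (u v)%:R * w 0 v.

(* Only meaningful for f != 0: the head of the support is then a monomial of  *)
(* f, so that it does not affect the minimum.                                 *)
Definition poly_weight (w : 'rV[R]_N) (f : poly) : R :=
  \big[Order.min/monomial_weight w (head 0%MM (msupp f))]_(u <- msupp f)
    monomial_weight w u.

Definition initial_form (w : 'rV[R]_N) (f : poly) : poly :=
  \sum_(u <- msupp f | monomial_weight w u == poly_weight w f) f@_u *: 'X_[u].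

Definition initial_algebra (w : 'rV[R]_N) (A : poly -> Prop) : poly -> Prop :=
  subalgebra_gen (fun g => exists2 f, A f & g = initial_form w f).

Definition khovanskii_basis (w : 'rV[R]_N) (A : poly -> Prop) (I : Type)
    (F : I -> poly) : Prop :=
  (forall g, A g <-> subalgebra_gen (fun h => exists i, h = F i) g) /\
  (forall g, initial_algebra w A g <->
     subalgebra_gen (fun h => exists i, h = initial_form w (F i)) g).

End Khovanskii.

Definition plucker_form (R : realType) (k n : nat) (I : ksubset k n) :
    {mpoly R[i][k * n]} :=
  \det (\matrix_(a < k, b < k) 'X_(mxvec_index a (elt I b))).

Definition plucker_algebra (R : realType) (k n : nat) :
    {mpoly R[i][k * n]} -> Prop :=
  subalgebra_gen (fun h => exists I : ksubset k n, h = plucker_form R I).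

Definition plucker_khovanskii (R : realType) (k n : nat) (M : 'M[R]_(k, n)) :
    Prop :=
  khovanskii_basis (mxvec M) (@plucker_algebra R k n)
    (fun I : ksubset k n => plucker_form R I).

Definition gives_toric_degeneration (R : realType) (k n : nat)
    (M : 'M[R]_(k, n)) (B : matching_field k n) : Prop :=
  [/\ generic_weight M, B = induced_matching_field M & plucker_khovanskii M].

(* Main.v *)
Require Import Defs.
From mathcomp Require Import all_boot all_order all_fingroup all_algebra.
From mathcomp Require Import zify ring.
From mathcomp Require Import reals complex mpoly.

Set Implicit Arguments.
Unset Strict Implicit.
Unset Printing Implicit Defensive.

Import Order.TTheory GRing.Theory Num.Theory.
Local Open Scope ring_scope.

(** Rows 2, ..., k of each weight matrix induce linear orders of the columns, and
    the entries of row r are n^(r-2) times digits in base n.  So the minimum over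
    the arrangements of a k-subset is found greedily from the last row upwards: the
    optimal column T is the [ordered] one, where T b comes after every T a, a < b,
    in the order of row b, and the initial form of the corresponding minor is plus
    or minus the monomial of T ([ordered_minimal], [leads_ordered]).

    A product of d minors of ordered columns therefore has the product of the column
    monomials as its initial form.  Write N_i(d) for the number of monomials obtained
    in this way from the orders of M_i.  Products with distinct initial monomials are
    linearly independent, so N_i(d) is at most the dimension of the degree d part of
    the Pluecker algebra.  If equality holds, these products form a basis, and no
    initial form of the algebra escapes the span of the N_i(d) monomials
    ([initial_form_sum]).

    Equality follows from a chain of inequalities.  By straightening, the degree d
    part is spanned by the products indexed by standard tableaux ([standard_span]),
    and a standard tableau can be recovered from its exponents, so that the dimension
    is at most N_0(d) ([card_standard]).  The step from M_(i-1) to M_i exchanges two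
    neighbours p, q in the order of one row l+1.  It changes precisely the columns
    having p in row l and q in row l+1, which then have q above p.  On exponents
    this is a piecewise linear bijection of the lattice, a combinatorial mutation
    ([tropical_map]).  It maps the sums of d old columns to sums of d new ones,
    because any tableau can first be rearranged, by exchanging the tails of columns
    below row l, so that the linear form of the mutation has a constant sign on its
    columns ([balance]).  Hence N_(i-1)(d) <= N_i(d) ([size_exponents_step]). *)

(** * Maximal minors and the Garnir relation *)

Definition column (k n : nat) := {ffun 'I_k -> 'I_n}.

Definition minor (F : comNzRingType) (k n : nat) (X : 'M[F]_(k, n))
    (T : 'I_k -> 'I_n) : F :=
  \det (\matrix_(a < k, b < k) X a (T b)).

Lemma minor_expand (F : comNzRingType) k n (X : 'M[F]_(k, n)) (T : 'I_k -> 'I_n) :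
  minor X T = \sum_(s : 'S_k) (-1) ^+ s * \prod_b X (s b) (T b).
Proof.
rewrite /minor -det_tr; apply: eq_bigr => s _; congr (_ * _).
by apply: eq_bigr => b _; rewrite !mxE.
Qed.

Lemma eq_minor (F : comNzRingType) k n (X : 'M[F]_(k, n)) (T T' : 'I_k -> 'I_n) :
  T =1 T' -> minor X T = minor X T'.
Proof. by move=> eqT; congr (\det _); apply/matrixP => a b; rewrite !mxE eqT. Qed.

Lemma minor_perm (F : comNzRingType) k n (X : 'M[F]_(k, n)) (T : 'I_k -> 'I_n)
    (s : 'S_k) :
  minor X (fun b => T (s b)) = (-1) ^+ s * minor X T.
Proof.
have -> : minor X (fun b => T (s b)) =
    \det (col_perm s (\matrix_(a < k, b < k) X a (T b))).
  by congr (\det _); apply/matrixP => a b; rewrite !mxE.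
by rewrite col_permE det_mulmx det_perm odd_permV mulrC.
Qed.

Lemma minor_repeat (F : comNzRingType) k n (X : 'M[F]_(k, n)) (T : 'I_k -> 'I_n) :
  ~~ injectiveb T -> minor X T = 0.
Proof.
case/injectivePn=> a [b neq_ab eqT]; rewrite /minor -det_tr.
by apply: (determinant_alternate neq_ab) => c; rewrite !mxE eqT.
Qed.

Section BigLift.
Variables (R : Type) (idx : R) (op : Monoid.com_law idx) (k : nat).

Lemma big_lift (P : pred 'I_k.+1) (G : 'I_k.+1 -> R) j :
  ~~ P j -> \big[op/idx]_(s | P s) G s =
            \big[op/idx]_(i | P (lift j i)) G (lift j i).
Proof.
move=> Pj; rewrite big_mkcond (bigD1_ord j) //= (negbTE Pj) Monoid.mul1m.
by rewrite [RHS]big_mkcond.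
Qed.

Lemma big_slots (a : 'I_k) (G : 'I_k.+1 -> R) :
  \big[op/idx]_i G i =
    op (\big[op/idx]_(b : 'I_k | (b <= a)%N) G (lift ord_max b))
       (\big[op/idx]_(b : 'I_k | ~~ (b < a)%N) G (lift ord0 b)).
Proof.
rewrite (bigID (fun i : 'I_k.+1 => (i <= a)%N)) /=; congr (op _ _).
  rewrite (@big_lift _ _ ord_max); last by rewrite -ltnNge ltn_ord.
  by apply: eq_bigl => b; rewrite lift_max.
by rewrite (@big_lift (fun i => ~~ (i <= a)%N) _ ord0).
Qed.

End BigLift.

Section Garnir.
Variables (F : comNzRingType) (k n : nat) (X : 'M[F]_(k, n)).
Variables (I J : 'I_k -> 'I_n) (a : 'I_k).

(** Together, the positions b >= a of the first column and the positions b <= a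
    of the second one form k+1 slots, filled with the entries of e permuted by s:
    slot b of the second column has index b, slot b of the first one b+1. *)
Definition garnir_left (e : 'I_k.+1 -> 'I_n) (s : 'S_k.+1) (b : 'I_k) : 'I_n :=
  if (b < a)%N then I b else e (s (lift ord0 b)).

Definition garnir_right (e : 'I_k.+1 -> 'I_n) (s : 'S_k.+1) (b : 'I_k) : 'I_n :=
  if (b <= a)%N then e (s (lift ord_max b)) else J b.

(** After expanding both minors, each pair of permutations assigns the k+1 slots
    to k rows.  Two slots share a row, so that the alternating sum over s is a
    determinant with two equal rows. *)
Lemma garnir_relation (e : 'I_k.+1 -> 'I_n) :
  \sum_(s : 'S_k.+1) (-1) ^+ s *
    (minor X (garnir_left e s) * minor X (garnir_right e s)) = 0.
Proof.
(* The row assigned to a slot by t, u, the permutations in the two expansions. *)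
pose row (t u : 'S_k) (s : 'I_k.+1) : 'I_k :=
  if (s <= a)%N then u (odflt a (unlift ord_max s))
  else t (odflt a (unlift ord0 s)).
pose rest (t u : 'S_k) := \prod_(b : 'I_k | (b < a)%N) X (t b) (I b) *
  \prod_(b : 'I_k | ~~ (b <= a)%N) X (u b) (J b).
have expand s (t u : 'S_k) :
    (\prod_b X (t b) (garnir_left e s b)) * (\prod_b X (u b) (garnir_right e s b))
    = rest t u * \prod_i X (row t u i) (e (s i)).
  rewrite (bigID (fun b : 'I_k => (b < a)%N)) /=.
  rewrite [\prod_b X (u b) _](bigID (fun b : 'I_k => (b <= a)%N)) /=.
  rewrite (big_slots _ a) /=.
  have -> : \prod_(b : 'I_k | (b < a)%N) X (t b) (garnir_left e s b) =
            \prod_(b : 'I_k | (b < a)%N) X (t b) (I b).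
    by apply: eq_bigr => b lt_ba; rewrite /garnir_left lt_ba.
  have -> : \prod_(b : 'I_k | ~~ (b <= a)%N) X (u b) (garnir_right e s b) =
            \prod_(b : 'I_k | ~~ (b <= a)%N) X (u b) (J b).
    by apply: eq_bigr => b /negbTE le_ba; rewrite /garnir_right le_ba.
  have -> : \prod_(b : 'I_k | ~~ (b < a)%N) X (t b) (garnir_left e s b) =
            \prod_(b : 'I_k | ~~ (b < a)%N)
              X (row t u (lift ord0 b)) (e (s (lift ord0 b))).
    apply: eq_bigr => b lt_ba.
    by rewrite /garnir_left /row liftK lift0 (negbTE lt_ba).
  have -> : \prod_(b : 'I_k | (b <= a)%N) X (u b) (garnir_right e s b) =
            \prod_(b : 'I_k | (b <= a)%N)
              X (row t u (lift ord_max b)) (e (s (lift ord_max b))).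
    apply: eq_bigr => b le_ba.
    by rewrite /garnir_right /row liftK lift_max le_ba.
  rewrite /rest -!mulrA; congr (_ * _); rewrite mulrCA [RHS]mulrCA; congr (_ * _).
  by rewrite mulrC.
have alt (t u : 'S_k) : \sum_(s : 'S_k.+1) (-1) ^+ s * \prod_i X (row t u i) (e (s i)) = 0.
  have /injectivePn[i [j neq_ij eq_row]] : ~~ injectiveb (row t u).
    by apply/negP => /injectiveP /leq_card; rewrite !card_ord ltnn.
  rewrite -[RHS](@determinant_alternate _ _
    (\matrix_(i, j) X (row t u i) (e j)) i j neq_ij) => [|c].
    by apply: eq_bigr => s _; congr (_ * _); apply: eq_bigr => c _; rewrite !mxE.
  by rewrite !mxE eq_row.
transitivity (\sum_(t : 'S_k) \sum_(u : 'S_k) (-1) ^+ t * (-1) ^+ u * rest t u *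
    \sum_(s : 'S_k.+1) (-1) ^+ s * \prod_i X (row t u i) (e (s i))).
  under [RHS]eq_bigr => t _ do under eq_bigr => u _ do rewrite mulr_sumr.
  under [RHS]eq_bigr => t _ do rewrite exchange_big.
  rewrite [RHS]exchange_big; apply: eq_bigr => s _.
  rewrite !minor_expand big_distrlr /= mulr_sumr; apply: eq_bigr => t _.
  rewrite mulr_sumr; apply: eq_bigr => u _.
  have /= := expand s t u.
  set A := \prod_b _; set B := \prod_b _; set D := \prod_i _ => eqAB.
  rewrite mulrACA eqAB {eqAB A B}.
  by move: (rest t u) D ((-1) ^+ s) ((-1) ^+ t) ((-1) ^+ u) => r D x y z; ring.
by apply: big1 => t _; apply: big1 => u _; rewrite alt mulr0.
Qed.

End Garnir.

(** * Straightening a pair of columns *)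

Definition increasing k n (T : 'I_k -> 'I_n) :=
  [forall a : 'I_k, forall b : 'I_k, (a < b)%N ==> (T a < T b)%N].

Lemma increasingP k n (T : 'I_k -> 'I_n) :
  reflect (forall a b : 'I_k, (a < b)%N -> (T a < T b)%N) (increasing T).
Proof.
apply: (iffP forallP) => [incT a b lt_ab | incT a].
  by have /forallP/(_ b)/implyP := incT a; apply.
by apply/forallP => b; apply/implyP; apply: incT.
Qed.

Definition column_sum k n (T : 'I_k -> 'I_n) : nat := \sum_b T b.

Section Straightening.
Variables (F : comNzRingType) (k n : nat) (X : 'M[F]_(k, n)).
Variables (I J : 'I_k -> 'I_n) (a : 'I_k).
Hypothesis incI : forall b c : 'I_k, (b < c)%N -> (I b < I c)%N.
Hypothesis incJ : forall b c : 'I_k, (b < c)%N -> (J b < J c)%N.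
Hypothesis descent : (J a < I a)%N.

(** The list J 0 < ... < J a < I a < ... < I (k-1): a strictly increasing choice of
    the entries to be permuted, for which s = 1 gives back I and J. *)
Definition slot (i : 'I_k.+1) : 'I_n :=
  if (i <= a)%N then J (odflt a (unlift ord_max i))
  else I (odflt a (unlift ord0 i)).

Lemma slot_left (b : 'I_k) : (a <= b)%N -> slot (lift ord0 b) = I b.
Proof. by move=> le_ab; rewrite /slot liftK lift0 ltnNge le_ab. Qed.

Lemma slot_right (b : 'I_k) : (b <= a)%N -> slot (lift ord_max b) = J b.
Proof. by move=> le_ba; rewrite /slot liftK lift_max le_ba. Qed.

Let left := garnir_left I a slot.
Let right := garnir_right J a slot.

Lemma column_sum_left s :
  column_sum (left s) =
  (\sum_(b : 'I_k | (b < a)%N) I b + \sum_(i : 'I_k.+1 | (a < i)%N) slot (s i))%N.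
Proof.
rewrite /column_sum (bigID (fun b : 'I_k => (b < a)%N)) /=; congr (_ + _)%N.
  by apply: eq_bigr => b lt_ba; rewrite /left /garnir_left lt_ba.
rewrite (@big_lift _ _ _ _ (fun i => (a < i)%N) _ ord0) //.
apply: eq_big => [b|b /negbTE lt_ba]; first by rewrite lift0 -leqNgt.
by rewrite /left /garnir_left lt_ba.
Qed.

Lemma column_sum_right s :
  column_sum (right s) =
  (\sum_(b : 'I_k | (a < b)%N) J b + \sum_(i : 'I_k.+1 | (i <= a)%N) slot (s i))%N.
Proof.
rewrite /column_sum (bigID (fun b : 'I_k => (a < b)%N)) /=; congr (_ + _)%N.
  by apply: eq_bigr => b lt_ab; rewrite /right /garnir_right leqNgt lt_ab.
rewrite (@big_lift _ _ _ _ (fun i => (i <= a)%N) _ ord_max); last first.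
  by rewrite -ltnNge ltn_ord.
apply: eq_big => [b|b]; first by rewrite lift_max -leqNgt.
by rewrite -leqNgt => le_ba; rewrite /right /garnir_right le_ba.
Qed.

Lemma left1 : left 1%g =1 I.
Proof.
move=> b; rewrite /left /garnir_left perm1; case: ltnP => // le_ab.
exact: slot_left.
Qed.

Lemma right1 : right 1%g =1 J.
Proof.
move=> b; rewrite /right /garnir_right perm1; case: leqP => // le_ba.
exact: slot_right.
Qed.

Lemma eq_column_sum (T T' : 'I_k -> 'I_n) : T =1 T' -> column_sum T = column_sum T'.
Proof. by move=> eqT; apply: eq_bigr => b _; rewrite eqT. Qed.

Lemma column_sum_garnir s :
  (column_sum (left s) + column_sum (right s) = column_sum I + column_sum J)%N.
Proof.
have total (u : 'S_k.+1) : (\sum_(i : 'I_k.+1 | (a < i)%N) slot (u i) +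
    \sum_(i : 'I_k.+1 | (i <= a)%N) slot (u i) = \sum_i slot i)%N.
  rewrite [RHS](reindex_inj (@perm_inj _ u)) /=.
  rewrite [RHS](bigID (fun i : 'I_k.+1 => (a < i)%N)) /=; congr (_ + _)%N.
  by apply: eq_bigl => i; rewrite -leqNgt.
have eqI := eq_column_sum left1; have eqJ := eq_column_sum right1.
move: eqI eqJ (total s) (total 1%g).
by rewrite !column_sum_left !column_sum_right; lia.
Qed.

(** The Young subgroup: permutations preserving the slots of each column. *)
Definition young (s : 'S_k.+1) := [forall i : 'I_k.+1, (a < i)%N ==> (a < s i)%N].

Lemma slot_large (i : 'I_k.+1) : (a < i)%N -> (I a <= slot i)%N.
Proof.
move=> lt_ai; have i0 : ord0 != i by apply/eqP=> i0; rewrite -i0 in lt_ai.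
have [b eq_i _] := unlift_some i0; move: lt_ai; rewrite eq_i lift0 ltnS => le_ab.
rewrite slot_left //; move: le_ab; rewrite leq_eqVlt => /orP[/eqP/val_inj <- //|].
by move/incI/ltnW.
Qed.

Lemma slot_small (i : 'I_k.+1) : (i <= a)%N -> (slot i < I a)%N.
Proof.
move=> le_ia; have iM : ord_max != i.
  by apply/eqP=> iM; move: le_ia; rewrite -iM leqNgt ltn_ord.
have [b eq_i _] := unlift_some iM; move: le_ia; rewrite eq_i lift_max => le_ba.
rewrite slot_right //; apply: leq_ltn_trans descent.
by move: le_ba; rewrite leq_eqVlt => /orP[/eqP/val_inj -> //|/incJ/ltnW].
Qed.

(** Entries moved out of the slots of I are at least I a; those which replace them
    are at most J a. *)
Lemma column_sum_decrease s : ~~ young s -> (column_sum (left s) < column_sum I)%N.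
Proof.
rewrite negb_forall => /existsP[i0]; rewrite negb_imply -leqNgt => /andP[lt_ai0 le_sa].
rewrite -(eq_column_sum left1) !column_sum_left ltn_add2l.
(* The excess over I a vanishes outside the slots of I, hence its sum over them
   cannot grow under a permutation. *)
pose excess (i : 'I_k.+1) := (slot i - I a)%N.
have excess_le : (\sum_(i : 'I_k.+1 | (a < i)%N) excess (s i) <=
                  \sum_(i : 'I_k.+1 | (a < i)%N) excess i)%N.
  have -> : (\sum_(i : 'I_k.+1 | (a < i)%N) excess i = \sum_i excess i)%N.
    rewrite [RHS](bigID (fun i : 'I_k.+1 => (a < i)%N)) /= [X in (_ + X)%N]big1 ?addn0 //.
    by move=> i; rewrite -leqNgt => /slot_small /ltnW; rewrite -subn_eq0 => /eqP.
  rewrite [leqRHS](reindex_inj (@perm_inj _ s)) /=.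
  by rewrite [leqRHS](bigID (fun i : 'I_k.+1 => (a < i)%N)) /= leq_addr.
have := leq_add excess_le (leqnn (\sum_(i : 'I_k.+1 | (a < i)%N) I a)%N).
rewrite -!big_split /=.
have -> : (\sum_(i : 'I_k.+1 | (a < i)%N) (excess i + I a) =
           \sum_(i : 'I_k.+1 | (a < i)%N) slot ((1 : 'S__) i)%g)%N.
  by apply: eq_bigr => i lt_ai; rewrite perm1 subnK ?slot_large.
apply: leq_trans; rewrite !(bigD1 i0 lt_ai0) /= -addSn; apply: leq_add.
  by have := slot_small le_sa; rewrite /excess; lia.
by apply: leq_sum => i _; rewrite /excess; lia.
Qed.

Lemma youngC s : young s -> forall i, (a < s i)%N = (a < i)%N.
Proof.
move/forallP=> ys i; pose H := [set i : 'I_k.+1 | (a < i)%N].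
have sH : s @: H = H.
  apply/eqP; rewrite eqEcard card_imset ?leqnn ?andbT; last exact: perm_inj.
  by apply/subsetP=> _ /imsetP[j + ->]; rewrite !inE => /(implyP (ys j)).
by have := mem_imset H i (@perm_inj _ s); rewrite sH !inE => ->.
Qed.

(** Such an s permutes the positions of I and of J separately, by permutations whose
    signs multiply to the sign of s. *)
Lemma young_term s : young s ->
  (-1) ^+ s * (minor X (left s) * minor X (right s)) = minor X I * minor X J.
Proof.
move=> /youngC ys.
pose f (b : 'I_k) : 'I_k :=
  if (b < a)%N then b else odflt b (unlift ord0 (s (lift ord0 b))).
pose g (b : 'I_k) : 'I_k :=
  if (b <= a)%N then odflt b (unlift ord_max (s (lift ord_max b))) else b.
have fP (b : 'I_k) : (a <= b)%N -> lift ord0 (f b) = s (lift ord0 b) /\ (a <= f b)%N.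
  move=> le_ab; have lt_as : (a < s (lift ord0 b))%N by rewrite ys lift0 ltnS.
  have s0 : ord0 != s (lift ord0 b) by apply/eqP=> s0; rewrite -s0 in lt_as.
  have [c eq_s un_s] := unlift_some s0.
  have -> : f b = c by rewrite /f ltnNge le_ab un_s.
  by split=> //; move: lt_as; rewrite eq_s lift0 ltnS.
have gP (b : 'I_k) : (b <= a)%N ->
    lift ord_max (g b) = s (lift ord_max b) /\ (g b <= a)%N.
  move=> le_ba; have le_as : (s (lift ord_max b) <= a)%N.
    by rewrite leqNgt ys -leqNgt lift_max.
  have sM : ord_max != s (lift ord_max b).
    by apply/eqP=> sM; move: le_as; rewrite -sM leqNgt ltn_ord.
  have [c eq_s un_s] := unlift_some sM.
  have -> : g b = c by rewrite /g le_ba un_s.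
  by split=> //; move: le_as; rewrite eq_s lift_max.
have f_id (b : 'I_k) : (b < a)%N -> f b = b by move=> lt_ba; rewrite /f lt_ba.
have g_id (b : 'I_k) : (a < b)%N -> g b = b by move=> lt_ab; rewrite /g leqNgt lt_ab.
have f_inj : injective f.
  move=> b c; case: (ltnP b a) => [lt_b | /[dup] le_b /fP[eq_b le_fb]];
    case: (ltnP c a) => [lt_c | /[dup] le_c /fP[eq_c le_fc]] eq_f.
  - by rewrite -(f_id b) // eq_f f_id.
  - by rewrite -eq_f f_id // leqNgt lt_b in le_fc.
  - by rewrite eq_f f_id // leqNgt lt_c in le_fb.
  - by apply: (@lift_inj _ ord0); apply: (@perm_inj _ s); rewrite -eq_b -eq_c eq_f.
have g_inj : injective g.
  move=> b c; case: (leqP b a) => [/[dup] le_b /gP[eq_b le_gb] | lt_b];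
    case: (leqP c a) => [/[dup] le_c /gP[eq_c le_gc] | lt_c] eq_g.
  - by apply: (@lift_inj _ ord_max); apply: (@perm_inj _ s); rewrite -eq_b -eq_c eq_g.
  - by rewrite eq_g g_id // leqNgt lt_c in le_gb.
  - by rewrite -eq_g g_id // leqNgt lt_b in le_gc.
  - by rewrite -(g_id b) // eq_g g_id.
pose sf := perm f_inj; pose sg := perm g_inj.
have -> : minor X (left s) = minor X (fun b => I (sf b)).
  apply: eq_minor => b; rewrite permE /left /garnir_left; case: ltnP => [/f_id ->//|].
  by case/fP=> <- le_af; rewrite slot_left.
have -> : minor X (right s) = minor X (fun b => J (sg b)).
  apply: eq_minor => b; rewrite permE /right /garnir_right; case: leqP => [|/g_id ->//].
  by case/gP=> <- le_ga; rewrite slot_right.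
have -> : s = (lift_perm ord0 ord0 sf * lift_perm ord_max ord_max sg)%g.
  apply/permP=> i; rewrite permM; case: (leqP i a) => [le_ia | lt_ai].
    have iM : ord_max != i.
      by apply/eqP=> iM; move: le_ia; rewrite -iM leqNgt ltn_ord.
    have -> : lift_perm ord0 ord0 sf i = i.
      case: (unliftP ord0 i) le_ia => [c ->|-> _]; last by rewrite lift_perm_id.
      by rewrite lift0 lift_perm_lift [sf _]permE => /f_id ->.
    have [b eq_i _] := unlift_some iM; move: le_ia; rewrite eq_i lift_max => /gP[<- _].
    by rewrite lift_perm_lift [sg _]permE.
  have i0 : ord0 != i by apply/eqP=> i0; rewrite -i0 in lt_ai.
  have [b eq_i _] := unlift_some i0; rewrite eq_i lift_perm_lift [sf _]permE.
  move: lt_ai; rewrite eq_i lift0 ltnS => /fP[eq_f le_f].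
  have : (a < lift ord0 (f b))%N by rewrite lift0 ltnS.
  rewrite eq_f; case: (unliftP ord_max (s (lift ord0 b))) => [c ->|-> _].
    by rewrite lift_max lift_perm_lift [sg _]permE => /g_id ->.
  by rewrite lift_perm_id.
rewrite !minor_perm odd_permM !odd_lift_perm !addbb !addFb signr_addb.
by rewrite [X in _ * X]mulrACA -signr_addb signrMK.
Qed.

(** The Garnir relation solved for minor X I * minor X J, which is the value of each
    Young term; by [column_sum_decrease] the first column of any other term has a
    smaller sum. *)
Lemma straightening :
  (minor X I * minor X J) *+ #|young| =
  - \sum_(s | ~~ young s) (-1) ^+ s * (minor X (left s) * minor X (right s)).
Proof.
have /eqP := garnir_relation X I J a slot; rewrite (bigID young) /= addr_eq0.
move=> /eqP <-; rewrite -sumr_const.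
by apply: eq_bigr => s ys; rewrite young_term.
Qed.

Lemma card_young : (0 < #|young|)%N.
Proof. by apply/card_gt0P; exists 1%g; apply/forallP=> i; rewrite perm1 implybb. Qed.

End Straightening.

(** * Linear spans of finite families *)

Section Span.
Variables (K : fieldType) (V : lmodType K).

Definition in_span (I : finType) (G : I -> V) (f : V) :=
  exists c : I -> K, f = \sum_i c i *: G i.

Variables (I : finType) (G : I -> V).

Lemma in_span0 : in_span G 0.
Proof. by exists (fun=> 0); rewrite big1 // => i _; rewrite scale0r. Qed.

Lemma in_spanD f g : in_span G f -> in_span G g -> in_span G (f + g).
Proof.
move=> [c ->] [c' ->]; exists (fun i => c i + c' i).
by rewrite -big_split; apply: eq_bigr => i _; rewrite scalerDl.
Qed.

Lemma in_spanZ c f : in_span G f -> in_span G (c *: f).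
Proof.
move=> [c' ->]; exists (fun i => c * c' i).
by rewrite scaler_sumr; apply: eq_bigr => i _; rewrite scalerA.
Qed.

Lemma in_spanN f : in_span G f -> in_span G (- f).
Proof. by rewrite -scaleN1r; apply: in_spanZ. Qed.

Lemma in_span_sum (L : Type) (r : seq L) (P : pred L) (E : L -> V) :
  (forall x, P x -> in_span G (E x)) -> in_span G (\sum_(x <- r | P x) E x).
Proof. by move=> spanE; elim/big_ind: _ => //; [exact: in_span0 | exact: in_spanD]. Qed.

Lemma in_span_gen i : in_span G (G i).
Proof.
exists (fun j => (j == i)%:R); rewrite (bigD1 i) //= eqxx scale1r big1 ?addr0 //.
by move=> j /negbTE->; rewrite scale0r.
Qed.

End Span.

Lemma in_span_trans (K : fieldType) (V : lmodType K) (I I' : finType)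
    (G : I -> V) (G' : I' -> V) f :
  in_span G f -> (forall i, in_span G' (G i)) -> in_span G' f.
Proof. by move=> [c ->] spanG; apply: in_span_sum => i _; apply: in_spanZ. Qed.

(** G is given by a matrix over the spanning family H; independence makes the matrix
    row free, and the cardinals make it square, hence invertible. *)
Lemma independent_spans (K : fieldType) (V : lmodType K) (I J : finType)
    (H : J -> V) (G : I -> V) :
    (forall i, in_span H (G i)) ->
    (forall c : I -> K, \sum_i c i *: G i = 0 -> forall i, c i = 0) ->
    (#|J| <= #|I|)%N ->
  forall j, in_span G (H j).
Proof.
move=> spanG freeG leJI j.
have /fin_all_exists[c G_def] i := spanG i.
pose M : 'M[K]_(#|I|, #|J|) := \matrix_(a, b) c (enum_val a) (enum_val b).
have sumE (L : finType) (E : L -> V) : \sum_i E i = \sum_(a < #|L|) E (enum_val a).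
  by rewrite (reindex_onto (@enum_val _ L) enum_rank) => [|i _];
     [apply: eq_bigl => a; rewrite enum_valK eqxx | rewrite enum_rankK].
have sumM (v : 'rV[K]_#|I|) :
    \sum_a v 0 a *: G (enum_val a) = \sum_b (v *m M) 0 b *: H (enum_val b).
  transitivity (\sum_a \sum_b (v 0 a * M a b) *: H (enum_val b)).
    apply: eq_bigr => a _; rewrite G_def sumE scaler_sumr.
    by apply: eq_bigr => b _; rewrite mxE scalerA.
  by rewrite exchange_big; apply: eq_bigr => b _; rewrite mxE scaler_suml.
have freeM : row_free M.
  rewrite -kermx_eq0; apply/eqP/row_matrixP => r; rewrite row0.
  have := sumM (row r (kermx M)).
  rewrite -row_mul mulmx_ker row0 [RHS]big1 => [|b _]; last by rewrite mxE scale0r.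
  set v := row r _ => v0; apply/rowP => a; rewrite [RHS]mxE.
  have := freeG (fun i => v 0 (enum_rank i)); rewrite sumE.
  under eq_bigr => b _ do rewrite enum_valK.
  by move=> /(_ v0 (enum_val a)); rewrite enum_valK.
have fullM : row_full M.
  by rewrite /row_full eqn_leq rank_leq_col (eqP freeM).
have /row_fullP[B BM] := fullM.
exists (fun i => B (enum_rank j) (enum_rank i)); rewrite sumE.
under eq_bigr => b _ do rewrite enum_valK.
transitivity (\sum_a row (enum_rank j) B 0 a *: G (enum_val a)); last first.
  by apply: eq_bigr => b _; rewrite mxE.
rewrite sumM -row_mul BM (bigD1 (enum_rank j)) //= !mxE eqxx scale1r enum_rankK.
rewrite big1 ?addr0 // => b; rewrite !mxE eq_sym => /negbTE->.
by rewrite scale0r.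
Qed.

(** * Standard tableaux span *)

Definition column_le k n (T T' : column k n) := [forall b, (T b <= T' b)%N].

Definition minors (F : comNzRingType) k n (X : 'M[F]_(k, n)) (t : seq (column k n)) :=
  \prod_(T <- t) minor X T.

Definition standard k n (t : seq (column k n)) :=
  all (fun T : column k n => increasing T) t && sorted (@column_le k n) t.

Lemma sort_column (F : comNzRingType) k n (X : 'M[F]_(k, n)) (T : column k n) :
    injectiveb T ->
  exists T' : column k n, [/\ increasing T', column_sum T' = column_sum T &
    exists e : bool, minor X T = (-1) ^+ e * minor X T'].
Proof.
move=> injT; pose u := [tuple T b | b < k].
have sz : size (sort (fun x y : 'I_n => (x <= y)%N) u) == k.
  by rewrite size_sort size_tuple.
have /tuple_permP[s sE] : perm_eq (Tuple sz) u by rewrite /= perm_sort.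
pose T' : column k n := [ffun b => T (s b)].
have T'E b : T' b = tnth (Tuple sz) b.
  rewrite ffunE (_ : Tuple sz = [tuple tnth u (s i) | i < k]) ?tnth_mktuple //.
  exact: val_inj.
exists T'; split.
- apply/increasingP => a b lt_ab; rewrite ltn_neqAle; apply/andP; split.
    apply: contraTneq lt_ab => /val_inj; rewrite !ffunE.
    by move=> /(injectiveP _ injT) /perm_inj ->; rewrite ltnn.
  rewrite !T'E !(tnth_nth (T a)) /=.
  have tr : transitive (fun x y : 'I_n => (x <= y)%N) by move=> x y z; apply: leq_trans.
  apply: (sorted_leq_nth tr) => //; rewrite ?inE ?(eqP sz) //; last exact: ltnW.
  by apply: sort_sorted => x y; apply: leq_total.
- rewrite /column_sum [RHS](reindex_inj (@perm_inj _ s)).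
  by apply: eq_bigr => b _; rewrite ffunE.
exists (odd_perm s).
rewrite (@eq_minor _ _ _ _ T' (fun b => T (s b))) => [|b]; last by rewrite ffunE.
by rewrite minor_perm signrMK.
Qed.

Lemma not_sorted (L : Type) (e : rel L) s :
  ~~ sorted e s -> exists s1 x y s2, s = s1 ++ x :: y :: s2 /\ ~~ e x y.
Proof.
elim: s => [|x [|y s] IHs] //=; rewrite negb_and => /orP[nexy|/IHs].
  by exists [::], x, y, s.
by move=> [s1 [x' [y' [s2 [-> nexy]]]]]; exists (x :: s1), x', y', s2.
Qed.

Section StandardSpan.
Variables (K : numFieldType) (V : comAlgType K) (k n : nat) (X : 'M[V]_(k, n)).
Local Notation col := (column k n).

(** A straightening step, applied to columns with sums S <= S', replaces these by
    S - e and S' + e with e > 0; this increases the sum of the squares. *)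
Definition spread (t : seq col) : nat := \sum_(T <- t) column_sum T ^ 2.

Lemma spread_max t : (spread t <= size t * (k * n) ^ 2)%N.
Proof.
rewrite /spread -sum1_size big_distrl /=; apply: leq_sum => T _.
rewrite mul1n leq_sqr /column_sum.
have -> : (k * n = \sum_(b < k) n)%N by rewrite sum_nat_const card_ord.
by apply: leq_sum => b _; apply/ltnW.
Qed.

Lemma sort_columns (t : seq col) : all (fun T : col => injectiveb T) t ->
  exists t' (e : bool), [/\ size t' = size t, all (fun T : col => increasing T) t',
    spread t' = spread t & minors X t = (-1) ^+ e * minors X t'].
Proof.
elim: t => [_ | T t IHt /= /andP[/(sort_column X)[T' [incT' sumT' [e eT]]]]].
  by exists [::], false; rewrite mul1r.
move=> /IHt[t' [e' [sz inc_t spr eqt]]]; exists (T' :: t'), (e (+) e').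
split=> /=; rewrite ?sz ?incT' //; last first.
  by rewrite /minors !big_cons eT -/(minors X t) eqt signr_addb mulrACA.
by rewrite /spread !big_cons sumT' -/(spread t') spr.
Qed.

Lemma minors_cat s1 s2 : minors X (s1 ++ s2) = minors X s1 * minors X s2.
Proof. by rewrite /minors big_cat. Qed.

(** Columns are sorted, then arranged by increasing sums.  If neighbours I, J fail
    I <= J, then I a > J a for some a, and all terms of the straightening relation
    have a larger spread, which is bounded. *)
Lemma standard_span d (t : seq col) : size t = d ->
  in_span (fun s : {s : d.-tuple col | standard s} => minors X (val s)) (minors X t).
Proof.
move: {2}(d * (k * n) ^ 2 - spread t).+1 (leqnn (d * (k * n) ^ 2 - spread t).+1) => m.
elim: m t => // m IHm t lt_m sz_t.
have [inj_t | ] := boolP (all (fun T : col => injectiveb T) t); last first.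
  case/allPn=> T /splitPr[s1 s2] ninjT.
  rewrite minors_cat /minors big_cons minor_repeat // mul0r mulr0.
  exact: in_span0.
have [t1 [e [sz1 inc1 spr1 ->]]] := sort_columns inj_t.
rewrite mulr_sign; suff: in_span (fun s : {s : d.-tuple col | standard s} =>
    minors X (val s)) (minors X t1) by case: e => //; apply: in_spanN.
pose t2 := sort (fun T T' : col => (column_sum T <= column_sum T')%N) t1.
have perm2 : perm_eq t2 t1 by rewrite perm_sort.
have -> : minors X t1 = minors X t2 by apply: perm_big; rewrite perm_sym.
have inc2 : all (fun T : col => increasing T) t2 by rewrite (perm_all _ perm2).
have sz2 : size t2 = d by rewrite (perm_size perm2) sz1.
have spr2 : spread t2 = spread t by rewrite -spr1; apply: perm_big.
have sum2 : sorted (fun T T' : col => (column_sum T <= column_sum T')%N) t2.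
  by apply: sort_sorted => T T'; apply: leq_total.
move: t2 inc2 sz2 spr2 sum2 {perm2} => t2 inc2 sz2 spr2 sum2.
have [std2 | /not_sorted[s1 [I [J [s2 [def_t2 nleIJ]]]]]] :=
  boolP (sorted (@column_le k n) t2).
  have std2' : standard (Tuple (introT eqP sz2)) by rewrite /standard /= inc2.
  exact: (in_span_gen (fun s : {s : d.-tuple col | standard s} => minors X (val s))
    (exist (fun s : d.-tuple col => standard s) (Tuple (introT eqP sz2)) std2')).
have /forallPn[a] := nleIJ; rewrite -ltnNge => descent.
move: inc2 sum2; rewrite {1 2}def_t2 all_cat /=.
move=> /and4P[_ /increasingP incI /increasingP incJ _].
move=> /cat_sorted2[_] /= /andP[sumIJ _].
have card_gt0 := card_young a.
have -> : minors X t2 = (#|young a|%:R^-1 : K) *: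
    (minors X s1 * minors X s2 * ((minor X I * minor X J) *+ #|young a|)).
  rewrite def_t2 minors_cat {2}/minors !big_cons -/(minors X s2).
  rewrite mulrnAr -scaler_nat scalerA mulVf ?pnatr_eq0 -?lt0n // scale1r.
  by rewrite -!mulrA; congr (_ * _); rewrite mulrA mulrC.
rewrite (straightening X I J a) mulrN; apply/in_spanZ/in_spanN.
rewrite mulr_sumr; apply: in_span_sum => s nys.
set L := garnir_left _ _ _ _; set R := garnir_right _ _ _ _.
pose L' : col := finfun L; pose R' : col := finfun R.
have eqL : L' =1 L by move=> b; rewrite ffunE.
have eqR : R' =1 R by move=> b; rewrite ffunE.
rewrite mulrCA -(eq_minor X eqL) -(eq_minor X eqR).
have -> : minors X s1 * minors X s2 * (minor X L' * minor X R') =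
          minors X (s1 ++ L' :: R' :: s2).
  rewrite minors_cat {4}/minors !big_cons -/(minors X s2) -!mulrA; congr (_ * _).
  by rewrite mulrC -!mulrA.
rewrite mulr_sign; suff: in_span (fun s : {s : d.-tuple col | standard s} =>
  minors X (val s)) (minors X (s1 ++ L' :: R' :: s2)).
  by case: ifP => // _; apply: in_spanN.
have sz' : size (s1 ++ L' :: R' :: s2) = d by rewrite -sz2 def_t2 !size_cat.
apply: IHm => //.
have spr_le : (spread (s1 ++ L' :: R' :: s2) <= d * (k * n) ^ 2)%N.
  by rewrite -sz'; apply: spread_max.
suff : (spread t2 < spread (s1 ++ L' :: R' :: s2))%N by rewrite spr2; lia.
have := column_sum_decrease incI incJ descent nys.
have := column_sum_garnir descent s.
rewrite -/L -/R -(eq_column_sum eqL) -(eq_column_sum eqR) => sum_eq sum_lt.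
rewrite def_t2 /spread !big_cat /= !big_cons ltn_add2l !addnA ltn_add2r.
by move: sumIJ sum_eq sum_lt; rewrite -!mulnn; nia.
Qed.

End StandardSpan.

(** * The row orders of the weight matrices *)

(** Position of j in the order 1..p-1, k+1..q, p, q+1..n, p+1..k of [n]. *)
Definition pos (k n p q j : nat) : nat :=
  if (k < j)%N then (j - k + p - (j <= q)%N)%N
  else if (j < p)%N then j
  else if j == p then (p + (q - k))%N else (j + (n - k))%N.

(** The order of row r once the step to (p, l, q) is done: rows up to l have moved
    p behind n, row l+1 has moved p behind q, and the lower rows have only moved the
    larger values, of which row r takes those from r on. *)
Definition row_pos (k n : nat) (t : triple) (r j : nat) : nat :=
  let: (p, l, q) := t in
  if (r <= l)%N then pos k n p n j
  else if r == l.+1 then pos k n p q j else pos k n (maxn p.+1 r) n j.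

(** The triples of the sequence; only the first one has p > k. *)
Definition valid_triple (k n : nat) (t : triple) : bool :=
  let: (p, l, q) := t in
  [&& (0 < l)%N, (l < p)%N, (k < q)%N, (q <= n)%N & (p <= k)%N || (t == (k.+1, k, n))].

(** Before it moves, p comes last among 1..p, so that the order is the final one
    for p+1. *)
Lemma pos_last k n p j : (p <= k)%N -> (k < n)%N -> (j <= n)%N ->
  pos k n p k j = pos k n p.+1 n j.
Proof. by move=> *; rewrite /pos; do ![case: ifP => ?]; lia. Qed.

(** A step touches the order of row l+1 only, where it moves p from behind q-1
    to behind q; for q = k+1, from its initial place. *)
Lemma row_pos_step k n t p l q : (k < n)%N -> valid_triple k n t ->
    next_triple k n t = Some (p, l, q) ->
  [/\ valid_triple k n (p, l, q), (p <= k)%N &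
    forall r j, (1 < r <= k)%N -> (0 < j <= n)%N -> row_pos k n t r j =
      if r == l.+1 then pos k n p q.-1 j else row_pos k n (p, l, q) r j].
Proof.
case: t => [[p0 l0] q0] ltkn /and5P[l0_gt0 lt_l0 lt_kq0 le_q0 start].
rewrite /next_triple; case: ifP => [lt_q0 [<- <- <-] | /negbT ge_q0].
  have le_p0 : (p0 <= k)%N by case/orP: start => // /eqP[_ _ eq_q0]; lia.
  split=> [|//|r j rP jP]; first by rewrite /valid_triple le_p0 /=; lia.
  by rewrite /row_pos /=; do ![case: ifP => ?]; lia.
have eq_q0 : q0 = n by lia.
rewrite eq_q0 eqxx /= andbT {eq_q0 q0 ge_q0 lt_kq0 le_q0} in start *.
case: ifP => [lt_l0p [<- <- <-] | /negbT ge_l0].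
  have le_p0 : (p0 <= k)%N by case/orP: start => // /eqP[]; lia.
  split=> [|//|r j rP jP]; first by rewrite /valid_triple le_p0 /=; lia.
  rewrite /row_pos /= pos_last; try lia.
  by do ![case: ifP => ?]; try congr (pos _ _ _ _ _); lia.
case: ifP => // /andP[gt2 /eqP eq_l0] [<- <- <-].
have le_p0 : (p0 - 1 <= k)%N by case/orP: start => [|/eqP[]]; lia.
split=> [|//|r j rP jP]; first by rewrite /valid_triple le_p0 /=; lia.
rewrite /row_pos /= pos_last; try lia.
by do ![case: ifP => ?]; try congr (pos _ _ _ _ _); lia.
Qed.

(** The step to (p, l, q) exchanges the neighbours p and q in the order of row l+1. *)
Lemma pos_swap k n p q j : (p <= k < q)%N -> (q <= n)%N -> (0 < j <= n)%N ->
  pos k n p q j = pos k n p q.-1 (if j == p then q else if j == q then p else j).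
Proof.
move=> pq qn jn; rewrite /pos.
case: (j =P p) => [->|jp]; last case: (j =P q) => [->|jq].
- by do ![case: ifP => ?]; lia.
- by do ![case: ifP => ?]; lia.
by do ![case: ifP => ?]; lia.
Qed.

Lemma run_triples_chain k n fuel t i :
    (i.+1 < size (run_triples k n fuel t))%N ->
  next_triple k n (nth (0, 0, 0)%N (run_triples k n fuel t) i) =
    Some (nth (0, 0, 0)%N (run_triples k n fuel t) i.+1).
Proof.
elim: fuel t i => [|f IHf] t i //=; case E: (next_triple k n t) => [t'|] //=.
case: i => [|i] /=; last exact: IHf.
by case: f {IHf} => [|f].
Qed.

Lemma triple_at_step k n i : (i.+1 < num_triples k n)%N ->
  next_triple k n (triple_at k n i) = Some (triple_at k n i.+1).
Proof. exact: run_triples_chain. Qed.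

Lemma triple_at0 k n : triple_at k n 0 = (k.+1, k, n).
Proof. by rewrite /triple_at /triples; case: (k * k * n)%N. Qed.

Lemma triple_at_valid k n i : (0 < k < n)%N -> (i < num_triples k n)%N ->
  valid_triple k n (triple_at k n i).
Proof.
move=> /andP[k_gt0 ltkn]; elim: i => [_|i IHi lt_i].
  by rewrite triple_at0 /valid_triple eqxx orbT /= k_gt0 ltnSn ltkn leqnn.
have := triple_at_step lt_i; case: (triple_at k n i.+1) => [[p l] q] next_i.
by have [] := row_pos_step ltkn (IHi (ltnW lt_i)) next_i.
Qed.

(** Within a row, weights decrease along the order. *)
Lemma weight_funE (R : realType) k n i : (0 < k < n)%N -> (i < num_triples k n)%N ->
  forall r j, (0 < r <= k)%N -> (0 < j <= n)%N ->
  weight_fun R k n i r j =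
    (if r == 1 then 0 else (n - row_pos k n (triple_at k n i) r j) * n ^ (r - 2))%N%:R.
Proof.
move=> /[dup] kn /andP[k_gt0 ltkn].
elim: i => [_|i IHi lt_i] r j rP jP.
  rewrite /= /diag_weight triple_at0; case: eqP => // /eqP r1.
  rewrite (_ : row_pos k n _ r j = j).
    by rewrite natrM natrX natrB //; case/andP: jP.
  by rewrite /row_pos /pos; do ![case: ifP => ?]; lia.
have := triple_at_valid kn lt_i; have := triple_at_step lt_i.
rewrite /=; case: (triple_at k n i.+1) => [[p l] q] next_i valid_plq.
have [_ le_pk pos_step] := row_pos_step ltkn (triple_at_valid kn (ltnW lt_i)) next_i.
have /and5P[l_gt0 lt_lp lt_kq le_qn _] := valid_plq.
rewrite /swap_entries; case: eqP => [eq_r | ne_r]; last first.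
  rewrite IHi ?(ltnW lt_i) //; case: eqP => // ne_r1.
  congr (_ * _)%N%:R; congr (_ - _)%N.
  by rewrite pos_step; [rewrite ifF //; apply/eqP | lia |].
rewrite IHi ?(ltnW lt_i) //; last by do ![case: ifP => ?]; lia.
rewrite ifF ?[in RHS]ifF; try lia; congr (_ * _)%N%:R; congr (_ - _)%N.
rewrite pos_step; [|lia|by do ![case: ifP => ?]; lia].
rewrite eq_r eqxx /row_pos ltnn eqxx [RHS]pos_swap //; lia.
Qed.

(** * Mutation of ordered columns *)

(** The arrangement of a set of entries where each row, from the last one upwards,
    takes the last entry that is left; the first row obeys no order.  The ranks rk
    refer to rows and entries counted from 1. *)
Definition ordered k n (rk : nat -> nat -> nat) (T : 'I_k -> 'I_n) : bool :=
  [forall a : 'I_k, forall b : 'I_k, (a < b)%N ==>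
    (rk b.+1 (T a).+1 < rk b.+1 (T b).+1)%N].

Lemma orderedP k n rk (T : 'I_k -> 'I_n) :
  reflect (forall a b : 'I_k, (a < b)%N ->
             (rk b.+1 (T a).+1 < rk b.+1 (T b).+1)%N) (ordered rk T).
Proof.
apply: (iffP forallP) => [ordT a b lt_ab | ordT a].
  by have /forallP/(_ b)/implyP := ordT a; apply.
by apply/forallP => b; apply/implyP; apply: ordT.
Qed.

Lemma eq_ordered k n (rk rk' : nat -> nat -> nat) (T : 'I_k -> 'I_n) :
    (forall r j, (1 < r <= k)%N -> (0 < j <= n)%N -> rk r j = rk' r j) ->
  ordered rk T = ordered rk' T.
Proof.
move=> eq_rk; apply/orderedP/orderedP => ordT a b lt_ab.
  by rewrite -!eq_rk ?ltn_ord ?(leq_ltn_trans _ lt_ab) ?ordT //; lia.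
by rewrite !eq_rk ?ltn_ord ?(leq_ltn_trans _ lt_ab) ?ordT //; lia.
Qed.

Section Mutation.
Variables (k n p l q : nat) (up low : 'I_k) (P Q : 'I_n).
Hypotheses (l_gt0 : (0 < l)%N) (lt_lp : (l < p)%N) (le_pk : (p <= k)%N).
Hypotheses (lt_kq : (k < q)%N) (le_qn : (q <= n)%N).
Hypotheses (upE : up.+1 = l) (lowE : low = l :> nat).
Hypotheses (PE : P.+1 = p) (QE : Q.+1 = q).
Local Notation col := (column k n).

(* The orders after and before the step. *)
Let new := row_pos k n (p, l, q).
Let old r j := if r == l.+1 then pos k n p q.-1 j else new r j.

(** The entries from p on, and those beyond q, in the old order of row l+1. *)
Definition in_upper (x : 'I_n) := (x == P) || (Q <= x)%N || (P < x < k)%N.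
Definition in_lower (x : 'I_n) := (Q < x)%N || (P < x < k)%N.

Lemma old_aboveE (b : 'I_k) j : (b < low)%N -> old b.+1 j = pos k n p n j.
Proof. by move=> lt_b; rewrite /old /new /row_pos ifF ?ifT //; lia. Qed.

Lemma old_lowE j : old low.+1 j = pos k n p q.-1 j.
Proof. by rewrite /old lowE eqxx. Qed.

Lemma old_belowE (b : 'I_k) j :
  (low < b)%N -> old b.+1 j = pos k n (maxn p.+1 b.+1) n j.
Proof. by move=> lt_b; rewrite /old /new /row_pos !ifF //; lia. Qed.

Lemma new_lowE j : new low.+1 j = pos k n p q j.
Proof. by rewrite /new /row_pos lowE ltnn eqxx. Qed.

Lemma new_otherE (b : 'I_k) j : b != low -> new b.+1 j = old b.+1 j.
Proof.
move=> neq_b; rewrite /old ifF //; apply: contra_neqF neq_b => /eqP[eq_b].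
by apply: val_inj; rewrite /= lowE.
Qed.

(** The entries that precede p, and hence q, in the old order of row l+1. *)
Definition early (x : 'I_n) := (x < P)%N || (k <= x < Q)%N.

Ltac unfold_lia :=
  rewrite ?/early ?/in_upper ?/in_lower -?val_eqE /=; rewrite /pos;
  do ?[case: ifP => ?]; lia.

Lemma old_low_lt_Q (x : 'I_n) :
  (old low.+1 x.+1 < old low.+1 Q.+1)%N -> x != P -> early x.
Proof. have xn := ltn_ord x; rewrite !old_lowE. unfold_lia. Qed.

Lemma old_up_early (x y : 'I_n) :
  (old up.+1 x.+1 < old up.+1 y.+1)%N -> early y -> early x.
Proof.
have xn := ltn_ord x; have yn := ltn_ord y.
rewrite !old_aboveE -?upE //; try lia. unfold_lia.
Qed.

Lemma early_old_up (x : 'I_n) : early x -> (old up.+1 x.+1 < old up.+1 Q.+1)%N.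
Proof. have xn := ltn_ord x; rewrite !old_aboveE; try lia. unfold_lia. Qed.

Lemma early_new_low (x : 'I_n) :
  early x || (x == Q) -> (new low.+1 x.+1 < new low.+1 P.+1)%N.
Proof. have xn := ltn_ord x; rewrite !new_lowE. unfold_lia. Qed.

Lemma early_old_low (x : 'I_n) : early x -> (old low.+1 x.+1 < old low.+1 Q.+1)%N.
Proof. have xn := ltn_ord x; rewrite !old_lowE. unfold_lia. Qed.

Lemma early_old_below (x : 'I_n) (b : 'I_k) : (low < b)%N ->
  early x || (x == P) -> (old b.+1 x.+1 < old b.+1 Q.+1)%N.
Proof.
move=> lt_b; have xn := ltn_ord x; have bk := ltn_ord b; rewrite !old_belowE //.
have := leq_maxl p.+1 b.+1; have : (maxn p.+1 b.+1 <= k.+1)%N by lia.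
move: (maxn _ _) => m. unfold_lia.
Qed.

(** A column that enters the upper set in row l stays there, and it lies beyond q in
    row l+1 unless it passes from p to q. *)
Lemma in_upper_low (x y : 'I_n) : (old low.+1 x.+1 < old low.+1 y.+1)%N ->
  in_upper x -> ~~ in_lower y -> x = P /\ y = Q.
Proof.
have xn := ltn_ord x; have yn := ltn_ord y; rewrite !old_lowE => lt_xy xU yL.
suff : x == P /\ y == Q by case=> /eqP-> /eqP->.
move: lt_xy xU yL; rewrite -!val_eqE. unfold_lia.
Qed.

Lemma not_upper (x : 'I_n) : ~~ in_upper x -> early x.
Proof. have xn := ltn_ord x; unfold_lia. Qed.

Lemma tail_position m (x y : 'I_n) : (m <= x.+1)%N -> (x < k)%N -> (0 < m)%N ->
  (pos k n m n x.+1 < pos k n m n y.+1)%N -> (x < y < k)%N.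
Proof. have yn := ltn_ord y. unfold_lia. Qed.

Lemma before_tail m (x y : 'I_n) : (p < m)%N -> early x || (x == P) ->
  (m <= y.+1)%N -> (y < k)%N -> (pos k n m n x.+1 < pos k n m n y.+1)%N.
Proof. have xn := ltn_ord x. have yn := ltn_ord y. unfold_lia. Qed.

(** Once a column takes an entry of p+1..k in row l+1, the rows below take larger and
    larger entries up to k, since their orders end in this way. *)
Lemma tail_chain (T : col) m (b : 'I_k) : ordered old T -> b = (low + m)%N :> nat ->
  (P < T low < k)%N -> (p + m <= T b < k)%N.
Proof.
move=> /orderedP ordT; elim: m b => [|m IHm] b eq_b T_low.
  by rewrite (_ : b = low); [lia | apply: val_inj; rewrite /= eq_b addn0].
have ltc : (low + m < k)%N by rewrite -addnS in eq_b *; have := ltn_ord b; lia.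
have := IHm (Ordinal ltc) erefl T_low; set c := Ordinal ltc => cP.
have lt_cb : (c < b)%N by rewrite /= eq_b; lia.
have := ordT c b lt_cb; rewrite !old_belowE; [|lia|lia].
move=> /tail_position H; have : (T c < T b < k)%N by apply: H; lia.
by lia.
Qed.

Lemma early_lt_lower (T : col) (b : 'I_k) (x : 'I_n) : ordered old T ->
    in_lower (T low) -> (low <= b)%N -> early x || (x == P) ->
  (old b.+1 x.+1 < old b.+1 (T b).+1)%N.
Proof.
move=> ordT T_low; rewrite leq_eqVlt => /orP[/eqP/val_inj<-|lt_b] xE.
  have xn := ltn_ord x; have yn := ltn_ord (T low); move: T_low xE; rewrite !old_lowE.
  unfold_lia.
case/orP: T_low => T_low.
  have := orderedP _ _ ordT _ _ lt_b; apply: leq_trans; rewrite ltnS; apply: ltnW.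
  apply: leq_trans (early_old_below lt_b xE) _.
  rewrite !old_belowE //; have := ltn_ord (T low); have := ltn_ord b.
  have := leq_maxl p.+1 b.+1; move: (maxn _ _) => m; unfold_lia.
have := @tail_chain T (b - low) b ordT _ T_low => H.
have Tb : (p + (b - low) <= T b < k)%N by apply: H; lia.
by rewrite !old_belowE //; apply: before_tail => //; lia.
Qed.

Definition swap_tail (T T' : col) : col :=
  [ffun a : 'I_k => if (a < low)%N then T a else T' a].

Lemma lt_up_low : (up < low)%N. Proof. by rewrite lowE -upE. Qed.

Lemma lt_low_up (a : 'I_k) : (a < low)%N -> (a < up)%N \/ a = up.
Proof.
rewrite lowE -upE ltnS leq_eqVlt => /orP[/eqP/val_inj ->|]; first by right.
by left.
Qed.

(** T has p, q in rows l, l+1, while T' goes from an early entry to one beyond q.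
    The entries of T above row l+1 are early or p, those of T' are early; both kinds
    precede the lower entries of the other column. *)
Lemma swap_tail_ordered (T T' : col) : ordered old T -> ordered old T' ->
    T up = P -> T low = Q -> ~~ in_upper (T' up) -> in_lower (T' low) ->
  ordered old (swap_tail T T') /\ ordered old (swap_tail T' T).
Proof.
move=> ordT ordT' T_up T_low T'_up T'_low.
have /orderedP oT := ordT; have /orderedP oT' := ordT'.
have earlyT (a : 'I_k) : (a < low)%N -> early (T a) || (T a == P).
  move=> lt_a; case: eqP => [|/eqP neqP]; first by rewrite orbT.
  by rewrite old_low_lt_Q // -T_low oT.
have earlyT' (a : 'I_k) : (a < low)%N -> early (T' a).
  case/lt_low_up => [lt_a|->]; last exact: not_upper.
  by apply: (@old_up_early _ (T' up)); [apply: oT' | apply: not_upper].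
split; apply/orderedP => a b lt_ab; rewrite !ffunE.
  case: (ltnP a low) => [lt_a | le_a].
    case: (ltnP b low) => [lt_b | le_b]; first exact: oT.
    by apply: early_lt_lower => //; apply: earlyT.
  by rewrite (_ : (b < low)%N = false); [apply: oT' | lia].
case: (ltnP a low) => [lt_a | le_a].
  case: (ltnP b low) => [lt_b | ]; first exact: oT'.
  rewrite leq_eqVlt => /orP[/eqP/val_inj<-|lt_b].
    by rewrite T_low early_old_low ?earlyT'.
  apply: (@ltn_trans (old b.+1 Q.+1)); first by rewrite early_old_below ?earlyT'.
  by rewrite -T_low oT.
by rewrite (_ : (b < low)%N = false); [apply: oT | lia].
Qed.

(** The columns that violate the new order of row l+1. *)
Definition mutable (T : col) := (T up == P) && (T low == Q).

Definition mutate (T : col) : col :=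
  if mutable T then [ffun a => if a == up then Q else if a == low then P else T a]
  else T.

Lemma old_new_low (x y : 'I_n) : ~~ ((x == P) && (y == Q)) ->
  (old low.+1 x.+1 < old low.+1 y.+1)%N -> (new low.+1 x.+1 < new low.+1 y.+1)%N.
Proof.
have xn := ltn_ord x; have yn := ltn_ord y; rewrite !old_lowE !new_lowE -!val_eqE /=.
unfold_lia.
Qed.

Lemma old_up_P (x : 'I_n) :
  (old up.+1 P.+1 < old up.+1 x.+1)%N -> ~~ early x && (x != P).
Proof.
have xn := ltn_ord x; rewrite !old_aboveE ?lt_up_low // -val_eqE. unfold_lia.
Qed.

(** No ordered column has p above row l and q in row l+1: row l would hold an entry
    behind p in its own order, hence one of p+1..k, but these are beyond q in the
    order of row l+1. *)
Lemma mutate_ordered (T : col) : ordered old T -> ordered new (mutate T).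
Proof.
move=> /orderedP ordT; rewrite /mutate.
case: ifP => [/andP[/eqP T_up /eqP T_low] | /negbT].
  have earlyT (a : 'I_k) : (a < up)%N -> early (T a).
    move=> lt_a; apply: old_low_lt_Q.
      by rewrite -T_low ordT // (ltn_trans lt_a) ?lt_up_low.
    by apply: contraTneq (ordT a up lt_a) => ->; rewrite T_up ltnn.
  have neq_ul : up != low by rewrite neq_ltn lt_up_low.
  apply/orderedP => a b lt_ab; rewrite !ffunE.
  case: (ltngtP b low) => [lt_b | lt_b | /val_inj eq_b].
  - rewrite (_ : (a == up) = false); last first.
      by apply: contraTF lt_ab => /eqP->; case/lt_low_up: lt_b => [|->]; lia.
    rewrite (_ : (a == low) = false); last first.
      by apply: contraTF lt_ab => /eqP->; lia.
    rewrite (_ : (b == low) = false); last by apply: contraTF lt_b => /eqP->; lia.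
    rewrite !new_otherE; try by apply: contraTneq lt_b => ->; lia.
    case/lt_low_up: lt_b => [lt_b | eq_b].
      by rewrite ifF ?ordT //; apply: contraTF lt_b => /eqP->; lia.
    by rewrite eq_b eqxx early_old_up ?earlyT // -eq_b.
  - rewrite !new_otherE; try by apply: contraTneq lt_b => ->; lia.
    have -> : (b == up) = false.
      by apply: contraTF lt_b => /eqP->; rewrite -leqNgt ltnW ?lt_up_low.
    rewrite (_ : (b == low) = false); last by apply: contraTF lt_b => /eqP->; lia.
    case: eqP => _; first by rewrite -T_low ordT.
    case: eqP => _; last exact: ordT.
    by rewrite -T_up ordT // (ltn_trans lt_up_low lt_b).
  rewrite eq_b in lt_ab *; rewrite eqxx [low == up]eq_sym (negbTE neq_ul).
  apply: early_new_low.
  case/lt_low_up: lt_ab => [lt_a|->]; last by rewrite !eqxx orbT.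
  rewrite (_ : (a == up) = false); last by apply: contraTF lt_a => /eqP->; lia.
  rewrite (_ : (a == low) = false) ?earlyT //.
  by apply: contraTF lt_a => /eqP->; rewrite -leqNgt ltnW ?lt_up_low.
move=> nmut; apply/orderedP => a b lt_ab.
case: (eqVneq b low) => [eq_b | neq_b]; last by rewrite !new_otherE ?ordT.
rewrite eq_b in lt_ab *; apply: old_new_low; last exact: ordT.
apply: contra nmut => /andP[/eqP T_a /eqP T_low]; rewrite /mutable T_low eqxx andbT.
case/lt_low_up: lt_ab => [lt_a | <-]; last by rewrite T_a.
have := ordT a up lt_a; rewrite T_a => /old_up_P /andP[early_up neqP].
case/negP: early_up; apply: old_low_lt_Q => //.
by rewrite -T_low ordT ?lt_up_low.
Qed.

(** Integer entries, so that the mutation acts on the whole lattice. *)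
Definition exponent (t : seq col) : 'M[int]_(k, n) :=
  \sum_(T <- t) \sum_a delta_mx a (T a).

(** The linear form of the mutation.  Its value on a single ordered column, the
    defect, is 1 on mutable columns, and 0 or -1 on the others. *)
Definition imbalance (x : 'M[int]_(k, n)) : int :=
  \sum_(j | in_upper j) x up j - \sum_(j | in_lower j) x low j.

Definition defect (T : col) : int := (in_upper (T up))%:Z - (in_lower (T low))%:Z.

(** What mutation subtracts from the exponents of a mutable column. *)
Definition exchange : 'M[int]_(k, n) :=
  delta_mx up P + delta_mx low Q - delta_mx up Q - delta_mx low P.

Lemma imbalanceD x y : imbalance (x + y) = imbalance x + imbalance y.
Proof.
rewrite /imbalance; under eq_bigr => j _ do rewrite mxE.
under [X in _ - X]eq_bigr => j _ do rewrite mxE.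
by rewrite !big_split /= opprD addrACA.
Qed.

Lemma imbalanceZ c x : imbalance (c *: x) = c * imbalance x.
Proof.
rewrite /imbalance; under eq_bigr => j _ do rewrite mxE.
by under [X in _ - X]eq_bigr => j _ do rewrite mxE; rewrite -!mulr_sumr mulrBr.
Qed.

Lemma imbalance_delta a j : imbalance (delta_mx a j) =
  ((a == up) && in_upper j)%:Z - ((a == low) && in_lower j)%:Z.
Proof.
rewrite /imbalance; under eq_bigr => i _ do rewrite mxE.
under [X in _ - X]eq_bigr => i _ do rewrite mxE.
have sumE (U : pred 'I_n) (b : bool) :
    \sum_(i | U i) ((b && (i == j))%:R : int) = (b && U j)%:Z.
  case: b => /=; last by rewrite big1.
  rewrite big_mkcond (bigD1 j) //= eqxx big1 ?addr0; first by case: (U j).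
  by move=> i /negbTE->; case: ifP.
by congr (_ - _); rewrite -sumE; apply: eq_bigr => i _; rewrite eq_sym.
Qed.

Lemma neq_up_low : up != low. Proof. by rewrite neq_ltn lt_up_low. Qed.

Lemma imbalance_exchange : imbalance exchange = 0.
Proof.
rewrite /exchange -!scaleN1r !imbalanceD !imbalanceZ !imbalance_delta !eqxx.
rewrite (negbTE neq_up_low) [low == up]eq_sym (negbTE neq_up_low) /=.
have -> : in_upper P by rewrite /in_upper eqxx.
have -> : in_upper Q by rewrite /in_upper leqnn orbT.
have -> : in_lower Q = false by rewrite /in_lower ltnn /=; lia.
by have -> : in_lower P = false by rewrite /in_lower ltnn /=; lia.
Qed.

Lemma imbalance_exponent t : imbalance (exponent t) = \sum_(T <- t) defect T.
Proof.
rewrite /exponent; elim: t => [|T t IHt].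
  by rewrite !big_nil -(scale0r (0 : 'M_(k, n))) imbalanceZ mul0r.
rewrite !big_cons imbalanceD IHt; congr (_ + _).
rewrite (bigD1 up) // (bigD1 low) 1?eq_sym ?neq_up_low //= addrA.
set rest := \sum_(a | _) _.
have -> : imbalance (delta_mx up (T up) + delta_mx low (T low) + rest) =
    defect T + imbalance rest.
  rewrite !imbalanceD !imbalance_delta !eqxx (negbTE neq_up_low) [low == _]eq_sym.
  by rewrite (negbTE neq_up_low) /= /defect subr0 sub0r.
suff -> : imbalance rest = 0 by rewrite addr0.
rewrite /rest; elim/big_ind: _ => [|x y x0 y0|a /andP[/negbTE nup /negbTE nlow]].
- by rewrite -(scale0r (0 : 'M_(k, n))) imbalanceZ mul0r.
- by rewrite imbalanceD x0 y0.
by rewrite imbalance_delta nup nlow.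
Qed.

Lemma defect_le1 (T : col) : defect T <= 1.
Proof. by rewrite /defect; case: in_upper; case: in_lower. Qed.

Lemma defect1 (T : col) : ordered old T -> (defect T == 1) = mutable T.
Proof.
move=> /orderedP/(_ _ _ lt_up_low) lt_T; apply/idP/idP; rewrite /defect /mutable.
  case: (boolP (in_upper (T up))) => U; case: (boolP (in_lower (T low))) => L //= _.
  by have [-> ->] := in_upper_low lt_T U L; rewrite !eqxx.
case/andP=> /eqP-> /eqP->.
have -> : in_upper P by rewrite /in_upper eqxx.
by have -> : in_lower Q = false by rewrite /in_lower ltnn /=; lia.
Qed.

Lemma exponent_seq1 (T : col) : exponent [:: T] =
  delta_mx up (T up) + delta_mx low (T low)
  + \sum_(a | (a != up) && (a != low)) delta_mx a (T a).
Proof.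
by rewrite /exponent big_seq1 (bigD1 up) // (bigD1 low) 1?eq_sym ?neq_up_low //= addrA.
Qed.

Lemma exponent_mutate (T : col) : exponent [:: mutate T] =
  exponent [:: T] - (mutable T)%:Z *: exchange.
Proof.
rewrite !exponent_seq1 /mutate; case: ifP => [/andP[/eqP T_up /eqP T_low]|_].
  rewrite !ffunE !eqxx [low == up]eq_sym (negbTE neq_up_low) T_up T_low.
  rewrite (eq_bigr (fun a => delta_mx a (T a))) => [|a /andP[/negbTE nup /negbTE nlow]].
    rewrite scale1r /exchange -[_ - _ - _]addrA -opprD opprB [RHS]addrC.
    by rewrite [RHS]addrA subrK.
  by rewrite ffunE nup nlow.
by rewrite scale0r subr0.
Qed.

Lemma exponent_cons (T : col) t : exponent (T :: t) = exponent [:: T] + exponent t.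
Proof. by rewrite /exponent big_cons big_seq1. Qed.

Lemma exponent_cat s t : exponent (s ++ t) = exponent s + exponent t.
Proof. by rewrite /exponent big_cat. Qed.

Lemma swap_tail_exponent (T T' : col) :
  exponent [:: swap_tail T T'; swap_tail T' T] = exponent [:: T; T'].
Proof.
rewrite /exponent !big_cons !big_nil !addr0 -!big_split.
by apply: eq_bigr => a _; rewrite !ffunE; case: ifP => // _; exact: addrC.
Qed.

(** A tail swap turns a pair of columns with defects 1 and -1 into one with defects
    0 and 0. *)
Lemma balance (t : seq col) : all (fun T : col => ordered old T) t ->
  exists t' : seq col, [/\ size t' = size t, all (fun T : col => ordered old T) t',
    exponent t' = exponent t &
    all (fun T : col => 0 <= defect T) t' || all (fun T : col => defect T <= 0) t'].
Proof.
move: {2}(count mutable t).+1 (ltnSn (count mutable t)) => m.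
elim: m t => // m IHm t lt_m ord_t.
case: (boolP (all (fun T : col => 0 <= defect T) t)) => [pos_t | /allPn[T' T't neg_T']].
  by exists t; rewrite pos_t.
case: (boolP (all (fun T : col => defect T <= 0) t)) => [neg_t | /allPn[T Tt pos_T]].
  by exists t; rewrite neg_t orbT.
have neqT : T' != T by apply: contraNneq neg_T' => ->; lia.
have permT := perm_to_rem Tt; set r := rem T t in permT.
have T'r : T' \in r by move: T't; rewrite (perm_mem permT) inE (negbTE neqT).
have permT' := perm_to_rem T'r; set r' := rem T' r in permT'.
have perm_t : perm_eq t (T :: T' :: r').
  by apply: perm_trans permT _; rewrite perm_cons.
have := ord_t; rewrite (perm_all _ perm_t) /= => /and3P[oT oT' or'].
have mutT : mutable T by rewrite -defect1 //; have := defect_le1 T; lia.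
have /andP[/eqP T_up /eqP T_low] := mutT.
have [T'_up T'_low] : ~~ in_upper (T' up) /\ in_lower (T' low).
  by move: neg_T'; rewrite /defect; case: in_upper; case: in_lower.
have [oS oS'] := swap_tail_ordered oT oT' T_up T_low T'_up T'_low.
set S := swap_tail T T' in oS; set S' := swap_tail T' T in oS'.
have ord_new : all (fun T : col => ordered old T) [:: S, S' & r'] by rewrite /= oS oS'.
have nS : mutable S = false.
  apply/negbTE; rewrite -defect1 // /defect !ffunE lt_up_low ltnn T'_low T_up.
  by rewrite /in_upper eqxx.
have nS' : mutable S' = false.
  apply/negbTE; rewrite -defect1 // /defect !ffunE lt_up_low ltnn (negbTE T'_up).
  by case: in_lower.
have lt_new : (count mutable [:: S, S' & r'] < m)%N.
  move: lt_m; rewrite ltnS; apply: leq_trans.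
  by rewrite (seq.permP perm_t) /= mutT nS nS' !add0n ltnS leq_addl.
have [t' [sz ord_t' exp_t' bal]] := IHm _ lt_new ord_new.
exists t'; split=> //; first by rewrite sz (perm_size perm_t).
rewrite exp_t' [RHS](perm_big _ perm_t) -/(exponent _).
rewrite (exponent_cat [:: S; S'] r') (exponent_cat [:: T; T'] r').
by rewrite swap_tail_exponent.
Qed.

(** The piecewise linear map of the combinatorial mutation; it is invertible since
    the imbalance vanishes on the direction of exchange. *)
Definition tropical_map (x : 'M[int]_(k, n)) : 'M[int]_(k, n) :=
  x - Num.max 0 (imbalance x) *: exchange.

Lemma tropical_map_inj : injective tropical_map.
Proof.
have invariant x : imbalance (tropical_map x) = imbalance x.
  by rewrite /tropical_map -scaleNr imbalanceD imbalanceZ imbalance_exchange mulr0 addr0.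
move=> x y eq_xy; have := congr1 imbalance eq_xy; rewrite !invariant => eq_imb.
by move: eq_xy; rewrite /tropical_map eq_imb => /addIr.
Qed.

(** On a balanced tableau, the positive part of the imbalance is the number of mutable
    columns, so that mutating each of these realises the map. *)
Lemma tropical_map_exponent (t : seq col) : all (fun T : col => ordered old T) t ->
  exists t' : seq col, [/\ size t' = size t, all (fun T : col => ordered new T) t' &
    exponent t' = tropical_map (exponent t)].
Proof.
case/balance=> u [sz_u ord_u <- sign_u].
exists (map mutate u); split; first by rewrite size_map.
  by rewrite all_map; apply: sub_all ord_u => T; apply: mutate_ordered.
have -> : exponent (map mutate u) = exponent u - (count mutable u)%:Z *: exchange.
  elim: {sz_u ord_u sign_u}u => [|T u IHu].
    by rewrite /exponent !big_nil scale0r subr0.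
  rewrite /= exponent_cons [in RHS]exponent_cons IHu exponent_mutate PoszD scalerDl.
  by rewrite opprD addrACA.
congr (_ - _ *: _); rewrite imbalance_exponent.
case/orP: sign_u => sign_u.
  have -> : (count mutable u)%:Z = \sum_(T <- u) defect T.
    elim: u ord_u sign_u {sz_u} => [|T u IHu] /=; first by rewrite big_nil.
    move=> /andP[oT ou] /andP[dT du]; rewrite big_cons -(IHu ou du) PoszD.
    congr (_ + _).
    by rewrite -defect1 //; have := defect_le1 T; case: eqP => [->//|]; lia.
  by apply/esym/max_idPr; rewrite big_seq; apply: sumr_ge0 => T; exact: (allP sign_u).
have -> : count mutable u = 0%N.
  apply/eqP; rewrite -leqn0 leqNgt -has_count; apply/hasPn => T Tu.
  by rewrite -defect1 ?(allP ord_u) //; have := allP sign_u T Tu; case: eqP => [->|].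
by apply/esym/max_idPl; rewrite big_seq; apply: sumr_le0 => T; exact: (allP sign_u).
Qed.

End Mutation.

(** * Counting exponents *)

Definition exponents d k n (rk : nat -> nat -> nat) : seq 'M[int]_(k, n) :=
  undup [seq exponent (val t) |
    t <- enum [pred t : d.-tuple (column k n) | all (fun T : column k n => ordered rk T) t]].

Lemma exponentsP d k n rk (x : 'M[int]_(k, n)) :
  reflect (exists t : seq (column k n),
             [/\ size t = d, all (fun T : column k n => ordered rk T) t & x = exponent t])
          (x \in exponents d k n rk).
Proof.
rewrite mem_undup; apply: (iffP mapP) => [[t + ->] | [t [sz_t ord_t ->]]].
  by rewrite mem_enum => ord_t; exists (val t); rewrite size_tuple.
by exists (Tuple (introT eqP sz_t)); rewrite ?mem_enum.
Qed.

Lemma size_exponents_step d k n t p l q : (k < n)%N -> valid_triple k n t ->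
    next_triple k n t = Some (p, l, q) ->
  (size (exponents d k n (row_pos k n t)) <=
   size (exponents d k n (row_pos k n (p, l, q))))%N.
Proof.
move=> ltkn valid_t /(row_pos_step ltkn valid_t)[valid_plq le_pk step].
have /and5P[l_gt0 lt_lp lt_kq le_qn _] := valid_plq.
have lt_up : (l.-1 < k)%N by lia.
have lt_low : (l < k)%N by lia.
have ltP : (p.-1 < n)%N by lia.
have ltQ : (q.-1 < n)%N by lia.
pose up := Ordinal lt_up; pose low := Ordinal lt_low.
pose P := Ordinal ltP; pose Q := Ordinal ltQ.
have upE : up.+1 = l by rewrite /=; lia.
have PE : P.+1 = p by rewrite /=; lia.
have QE : Q.+1 = q by rewrite /=; lia.
have lowE : low = l :> nat by [].
have inj := tropical_map_inj l_gt0 lt_lp le_pk lt_kq le_qn upE lowE PE QE.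
rewrite -(size_map (tropical_map up low P Q)); apply: uniq_leq_size.
  by rewrite (map_inj_uniq inj) undup_uniq.
move=> _ /mapP[x /exponentsP[u [sz_u ord_u ->]] ->].
have [|v [sz_v ord_v <-]] := tropical_map_exponent l_gt0 lt_lp le_pk lt_kq le_qn upE
    lowE PE QE (t := u).
  by apply: sub_all ord_u => T; rewrite (eq_ordered _ step).
by apply/exponentsP; exists v; rewrite sz_v.
Qed.

Lemma size_exponents_mono d k n i : (0 < k < n)%N -> (i < num_triples k n)%N ->
  (size (exponents d k n (row_pos k n (k.+1, k, n))) <=
   size (exponents d k n (row_pos k n (triple_at k n i))))%N.
Proof.
move=> kn; have ltkn : (k < n)%N by lia.
elim: i => [|i IHi lt_i]; first by rewrite triple_at0.
apply: leq_trans (IHi (ltnW lt_i)) _; have := triple_at_step lt_i.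
case: (triple_at k n i.+1) => [[p l] q]; apply: size_exponents_step => //.
exact: triple_at_valid (ltnW lt_i).
Qed.

Lemma exponentE k n (t : seq (column k n)) a j :
  exponent t a j = (count (fun T : column k n => T a == j) t)%:Z.
Proof.
rewrite /exponent; elim: t => [|T t IHt]; first by rewrite big_nil mxE.
rewrite big_cons mxE IHt /= PoszD; congr (_ + _).
rewrite summxE (bigD1 a) //= mxE eqxx eq_sym big1 ?addr0; first by case: (T a == j).
by move=> b; rewrite mxE eq_sym => /negbTE->.
Qed.

Lemma ordered_start k n (T : 'I_k -> 'I_n) : (k < n)%N ->
  ordered (row_pos k n (k.+1, k, n)) T = increasing T.
Proof.
move=> ltkn.
rewrite (@eq_ordered _ _ _ (fun _ j => j)) => [|r j rP jP]; last first.
  by rewrite /row_pos /pos; do ![case: ifP => ?]; lia.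
by apply/orderedP/increasingP => ordT a b /ordT; rewrite ltnS.
Qed.

(** The rows are weakly increasing, hence determined by their contents. *)
Lemma standard_exponent_inj k n (t u : seq (column k n)) :
    standard t -> standard u -> size t = size u -> exponent t = exponent u ->
  t = u.
Proof.
move=> /andP[_ sort_t] /andP[_ sort_u] eq_sz eq_exp.
have tr : transitive (fun x y : 'I_n => (x <= y)%N) by move=> x y z; apply: leq_trans.
have row_sorted (s : seq (column k n)) a : sorted (@column_le k n) s ->
    sorted (fun x y : 'I_n => (x <= y)%N) [seq T a | T : column k n <- s].
  by move=> sort_s; apply: homo_sorted sort_s => T T' /forallP/(_ a).
have eq_row a : [seq T a | T : column k n <- t] = [seq T a | T : column k n <- u].
  apply: (sorted_eq tr); rewrite ?row_sorted //.
    by move=> x y le_xy; apply/val_inj/anti_leq.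
  apply/allP => j _; rewrite /= !count_map; apply/eqP.
  by have := congr1 (fun x : 'M_(k, n) => x a j) eq_exp; rewrite !exponentE => -[].
case: t eq_sz {eq_exp sort_t} eq_row => [|T0 t] eq_sz eq_row.
  by case: u eq_sz {sort_u eq_row}.
apply: (@eq_from_nth _ T0) => // i lt_i; apply/ffunP => a.
have := congr1 (fun s => nth (T0 a) s i) (eq_row a).
by rewrite !(nth_map T0) // -eq_sz.
Qed.

Lemma card_standard d k n : (k < n)%N ->
  (#|{: {s : d.-tuple (column k n) | standard s}}| <=
   size (exponents d k n (row_pos k n (k.+1, k, n))))%N.
Proof.
move=> ltkn; rewrite cardE.
rewrite -(size_map (fun s : {s : d.-tuple (column k n) | standard s} => exponent (val s))).
apply: uniq_leq_size.
  rewrite map_inj_uniq ?enum_uniq // => s s' eq_exp.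
  by apply/val_inj/val_inj/standard_exponent_inj;
     rewrite ?size_tuple ?(valP s) ?(valP s').
move=> _ /mapP[s _ ->]; apply/exponentsP; exists (val (val s)).
rewrite size_tuple; split=> //; have /andP[inc_s _] := valP s.
by apply: sub_all inc_s => T; rewrite ordered_start.
Qed.

(** * Minimality of ordered columns *)

Lemma pos_le k n p q j : (0 < p <= k.+1)%N -> (p <= k)%N || (q == n) ->
  (k <= q <= n)%N -> (k < n)%N -> (0 < j <= n)%N -> (0 < pos k n p q j <= n)%N.
Proof. by move=> *; rewrite /pos; do ![case: ifP => ?]; lia. Qed.

Lemma row_pos_le k n t r j : (k < n)%N -> valid_triple k n t -> (1 < r <= k)%N ->
  (0 < j <= n)%N -> (0 < row_pos k n t r j <= n)%N.
Proof.
case: t => [[p l] q] ltkn /and5P[l_gt0 lt_lp lt_kq le_qn start] rP jP.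
have start' : (p <= k)%N || [&& p == k.+1, l == k & q == n].
  by case/orP: start => [->//|/eqP[-> -> ->]]; rewrite !eqxx orbT.
by rewrite /row_pos; do ![case: ifP => ?]; apply: pos_le => //; lia.
Qed.

Lemma pos_inj k n p q i j : (0 < p <= k.+1)%N -> (p <= k)%N || (q == n) ->
    (k <= q <= n)%N -> (k < n)%N -> (0 < i <= n)%N -> (0 < j <= n)%N ->
  pos k n p q i = pos k n p q j -> i = j.
Proof. by move=> ? ? ? ? ? ?; rewrite /pos; do ![case: ifP => ?]; lia. Qed.

Lemma row_pos_inj k n t r i j : (k < n)%N -> valid_triple k n t -> (1 < r <= k)%N ->
  (0 < i <= n)%N -> (0 < j <= n)%N -> row_pos k n t r i = row_pos k n t r j -> i = j.
Proof.
case: t => [[p l] q] ltkn /and5P[l_gt0 lt_lp lt_kq le_qn start] rP iP jP.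
have start' : (p <= k)%N || [&& p == k.+1, l == k & q == n].
  by case/orP: start => [->//|/eqP[-> -> ->]]; rewrite !eqxx orbT.
by rewrite /row_pos; do ![case: ifP => ?]; apply: pos_inj => //; lia.
Qed.

Section Digits.
Variables (k n : nat) (rk : nat -> nat -> nat).
Hypothesis rk_range : forall r j, (1 < r <= k)%N -> (0 < j <= n)%N -> (0 < rk r j <= n)%N.

Definition digit_weight (a j : nat) : nat :=
  if a == 0%N then 0%N else ((n - rk a.+1 j.+1) * n ^ a.-1)%N.

(** The rows are digits in base n, the last row being the most significant one; the
    first row has weight 0. *)
Lemma digits_lt (T : 'I_k -> 'I_n) m : (0 < m <= k)%N ->
  (\sum_(a : 'I_k | (a < m)%N) digit_weight a (T a) < n ^ m.-1)%N.
Proof.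
case: m => // m; elim: m => [|m IHm] lt_mk.
  by rewrite big1 // => a; rewrite ltnS leqn0 /digit_weight => ->.
pose b := Ordinal lt_mk.
rewrite (bigD1 b) //= (eq_bigl (fun a : 'I_k => (a < m.+1)%N)) => [|a].
  have := IHm (ltnW lt_mk); rewrite /= /digit_weight /= => IH.
  have := @rk_range m.+2 (T b).+1; have := ltn_ord (T b); rewrite expnS => lt_T rkP.
  have : (0 < rk m.+2 (T b).+1 <= n)%N by apply: rkP; lia.
  move: IH; set S := (\sum_(_ | _) _)%N => IH.
  by move: (rk _ _) (n ^ m)%N IH => x N; nia.
by rewrite -val_eqE /=; lia.
Qed.

Lemma digit_weight_lt (T T' : 'I_k -> 'I_n) (m : 'I_k) : (0 < m)%N ->
    (forall a : 'I_k, (m < a)%N -> T a = T' a) ->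
    (rk m.+1 (T' m).+1 < rk m.+1 (T m).+1)%N ->
  (\sum_(a < k) digit_weight a (T a) < \sum_(a < k) digit_weight a (T' a))%N.
Proof.
move=> m_gt0 eqT lt_rk.
have split_m (U : 'I_k -> 'I_n) : (\sum_(a < k) digit_weight a (U a) =
    \sum_(a : 'I_k | (a < m)%N) digit_weight a (U a) +
    (digit_weight m (U m) + \sum_(a : 'I_k | (m < a)%N) digit_weight a (U a)))%N.
  rewrite (bigID (fun a : 'I_k => (a < m)%N)) /=; congr (_ + _)%N.
  rewrite (bigD1 m) /= -?leqNgt //; congr (_ + _)%N.
  by apply: eq_bigl => a; rewrite -val_eqE /=; lia.
rewrite !split_m.
have -> : (\sum_(a : 'I_k | (m < a)%N) digit_weight a (T' a) =
           \sum_(a : 'I_k | (m < a)%N) digit_weight a (T a))%N.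
  by apply: eq_bigr => a lt_ma; rewrite eqT.
rewrite !addnA ltn_add2r; apply: leq_trans (leq_addl _ _).
have := @digits_lt T m; rewrite m_gt0 (ltnW (ltn_ord m)) => /(_ isT).
have T_le : (rk m.+1 (T m).+1 <= n)%N.
  have lt_mk := ltn_ord m; have lt_Tm := ltn_ord (T m).
  by have := @rk_range m.+1 (T m).+1; lia.
have digitE j : digit_weight m j = ((n - rk m.+1 j.+1) * n ^ m.-1)%N.
  by rewrite /digit_weight ifF; lia.
rewrite !digitE.
have : ((n - rk m.+1 (T m).+1).+1 * n ^ m.-1 <= (n - rk m.+1 (T' m).+1) * n ^ m.-1)%N.
  by rewrite leq_mul2r; lia.
by rewrite mulSn => le_m lt_S; apply: leq_trans le_m; rewrite -addSn leq_add2r.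
Qed.

(** When an ordered column is permuted, the last row to change gets an earlier,
    hence heavier, entry. *)
Lemma ordered_minimal (T : 'I_k -> 'I_n) (s : 'S_k) : ordered rk T -> s != 1%g ->
  (\sum_(a < k) digit_weight a (T a) < \sum_(a < k) digit_weight a (T (s a)))%N.
Proof.
move=> /orderedP ordT neq_s1.
have [b0 sb0] : exists b, s b != b.
  apply/existsP; apply: contraNT neq_s1; rewrite negb_exists => /forallP s1.
  by apply/eqP/permP => a; rewrite perm1; apply/eqP; have := s1 a; rewrite negbK.
case: (@arg_maxnP _ b0 (fun b => s b != b) (fun a : 'I_k => a : nat) sb0) => m sm max_m.
have fix_s (a : 'I_k) : (m < a)%N -> s a = a.
  by move=> lt_ma; apply/eqP; apply: contraTT lt_ma => /max_m; rewrite -leqNgt.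
have lt_sm : (s m < m)%N.
  rewrite ltn_neqAle sm leqNgt; apply: contra sm => /fix_s eq_ssm.
  by rewrite -(inj_eq (@perm_inj _ s)) eq_ssm.
apply: digit_weight_lt (ordT _ _ lt_sm); first exact: leq_ltn_trans lt_sm.
by move=> a /fix_s ->.
Qed.

Hypothesis rk_inj : forall r i j, (1 < r <= k)%N -> (0 < i <= n)%N -> (0 < j <= n)%N ->
  rk r i = rk r j -> i = j.

(** Arrangements of a set are compared at the last row where they differ, which is
    not the first row. *)
Lemma digit_weight_inj (T : 'I_k -> 'I_n) (s t : 'S_k) : injective T ->
    (\sum_(a < k) digit_weight a (T (s a)) = \sum_(a < k) digit_weight a (T (t a)))%N ->
  s = t.
Proof.
move=> injT eq_w; apply/eqP; apply: contra_eqT eq_w => neq_st.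
have [b0 sb0] : exists b, s b != t b.
  apply/existsP; apply: contraNT neq_st; rewrite negb_exists => /forallP st.
  by apply/eqP/permP => a; apply/eqP; have := st a; rewrite negbK.
case: (@arg_maxnP _ b0 (fun b => s b != t b) (fun a : 'I_k => a : nat) sb0) => m sm max_m.
have eq_st (a : 'I_k) : (m < a)%N -> s a = t a.
  by move=> lt_ma; apply/eqP; apply: contraTT lt_ma => /max_m; rewrite -leqNgt.
have m_gt0 : (0 < m)%N.
  rewrite lt0n; apply: contra sm => /eqP m0.
  have eq_s (a : 'I_k) : a != m -> s a = t a.
    by rewrite -val_eqE /= m0 => a0; apply: eq_st; rewrite m0 lt0n.
  have : t (s^-1 (t m))%g = s (s^-1 (t m))%g \/ (s^-1 (t m))%g = m.
    by case: (eqVneq (s^-1 (t m))%g m) => [|/eq_s ->]; [right | left].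
  rewrite permKV; case=> [/perm_inj eq_m | eq_m]; apply/eqP.
    by rewrite -{1}eq_m permKV.
  by rewrite -{1}eq_m permKV.
have lt_mk := ltn_ord m; have sP := ltn_ord (T (s m)); have tP := ltn_ord (T (t m)).
case: (ltngtP (rk m.+1 (T (s m)).+1) (rk m.+1 (T (t m)).+1)) => [lt_rk|lt_rk|eq_rk].
- by rewrite neq_ltn (digit_weight_lt m_gt0 _ lt_rk) ?orbT // => a /eq_st ->.
- by rewrite neq_ltn (digit_weight_lt m_gt0 _ lt_rk) // => a /eq_st ->.
have [] : (T (s m)).+1 = (T (t m)).+1 by apply: rk_inj eq_rk; lia.
by move/val_inj/injT => eq_m; rewrite eq_m eqxx in sm.
Qed.

End Digits.

(** * Initial forms of linear combinations *)

Section LeadingForm.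
Variables (R : realType) (N : nat) (w : 'rV[R]_N).
Local Notation poly := {mpoly R[i][N]}.
Local Notation wt := (monomial_weight w).

Lemma monomial_weightD u v : wt (u + v)%MM = wt u + wt v.
Proof.
rewrite /monomial_weight -big_split; apply: eq_bigr => i _.
by rewrite mnmDE natrD mulrDl.
Qed.

Definition heavier (c : R) (f : poly) := forall m, m \in msupp f -> c < wt m.

Lemma heavier0 c : heavier c 0.
Proof. by move=> m; rewrite msupp0. Qed.

Lemma heavierD c f g : heavier c f -> heavier c g -> heavier c (f + g).
Proof. by move=> cf cg m /msuppD_le; rewrite mem_cat => /orP[/cf|/cg]. Qed.

Lemma heavierZ c a f : heavier c f -> heavier c (a *: f).
Proof. by move=> cf m /msuppZ_le /cf. Qed.

Lemma heavierX c u : c < wt u -> heavier c 'X_[u].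
Proof. by move=> lt_c m; rewrite msuppX inE => /eqP->. Qed.

Lemma heavierM c d f g : heavier c f -> heavier d g -> heavier (c + d) (f * g).
Proof.
move=> cf dg m /msuppM_le /allpairsP[[m1 m2] [/= /cf lt1 /dg lt2 ->]].
by rewrite monomial_weightD ltrD.
Qed.

Lemma heavierXl c u f : heavier c f -> heavier (wt u + c) ('X_[u] * f).
Proof.
move=> cf m /msuppM_le /allpairsP[[m1 m2] [/= + /cf lt2 ->]].
by rewrite msuppX inE => /eqP->; rewrite monomial_weightD ltrD2l.
Qed.

(** The monomial u is the initial form of f, with coefficient 1. *)
Definition leads (f : poly) (u : 'X_{1..N}) := heavier (wt u) (f - 'X_[u]).

Lemma leads1 : leads 1 0%MM.
Proof. by rewrite /leads mpolyX0 subrr; apply: heavier0. Qed.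

Lemma leadsM f g u v : leads f u -> leads g v -> leads (f * g) (u + v)%MM.
Proof.
rewrite /leads monomial_weightD mpolyXD => lf lg.
have -> : f * g - 'X_[u] * 'X_[v] =
    'X_[u] * (g - 'X_[v]) + ('X_[v] * (f - 'X_[u]) + (f - 'X_[u]) * (g - 'X_[v])) by ring.
apply: heavierD; first exact: heavierXl.
by apply: heavierD; [rewrite addrC; apply: heavierXl | apply: heavierM].
Qed.

Lemma leads_coeff f u m : leads f u -> wt m <= wt u -> f@_m = (u == m)%:R.
Proof.
move=> lf le_m; apply/eqP; rewrite -subr_eq0 -mcoeffX -mcoeffB mcoeff_eq0.
by apply/negP => /lf; rewrite ltNge le_m.
Qed.

Lemma initial_form_coeff f m :
  (initial_form w f)@_m = if wt m == poly_weight w f then f@_m else 0.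
Proof.
rewrite /initial_form big_mkcond /= (big_morph _ (mcoeffD m) (mcoeff0 _ m)).
have term (u : 'X_{1..N}) :
    (if wt u == poly_weight w f then f@_u *: 'X_[u] else 0)@_m =
    if u == m then (if wt m == poly_weight w f then f@_m else 0) else 0.
  case: (eqVneq u m) => [->|/negbTE neq]; case: ifP => _; rewrite ?mcoeff0 //.
    by rewrite mcoeffZ mcoeffX eqxx mulr1.
  by rewrite mcoeffZ mcoeffX neq mulr0.
under eq_bigr => u _ do rewrite term.
have [m_in | m_out] := boolP (m \in msupp f).
  rewrite (bigD1_seq m) ?msupp_uniq //= eqxx big1 ?addr0 //.
  by move=> u /negbTE->.
rewrite big_seq big1 ?(memN_msupp_eq0 m_out) ?if_same // => u u_in.
by case: eqP => // eq_um; rewrite -eq_um u_in in m_out.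
Qed.

Lemma initial_form0 : initial_form w 0 = 0.
Proof. by rewrite /initial_form msupp0 big_nil. Qed.

Lemma poly_weight_eq f u : u \in msupp f -> (forall m, m \in msupp f -> wt u <= wt m) ->
  poly_weight w f = wt u.
Proof.
move=> u_in min_u; apply/eqP; rewrite eq_le /poly_weight ge_bigmin_seq //=.
rewrite big_seq le_bigmin // min_u //.
by case: (msupp f) u_in => // v s _; rewrite mem_head.
Qed.

Section Family.
Variables (I : finType) (G : I -> poly) (u : I -> 'X_{1..N}).
Hypotheses (u_inj : injective u) (leadsG : forall i, leads (G i) (u i)).

(** Up to the minimal weight of the leading monomials, only these contribute. *)
Lemma leading_coeff (c : I -> R[i]) i0 :
    (forall i, c i != 0 -> wt (u i0) <= wt (u i)) ->
  forall m, wt m <= wt (u i0) ->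
  (\sum_i c i *: G i)@_m = \sum_i c i * (u i == m)%:R.
Proof.
move=> min_i0 m le_m; rewrite (big_morph _ (mcoeffD m) (mcoeff0 _ m)).
apply: eq_bigr => i _; rewrite mcoeffZ.
have [-> | nz_ci] := eqVneq (c i) 0; first by rewrite !mul0r.
by rewrite (leads_coeff (@leadsG i)) // (le_trans le_m (min_i0 i nz_ci)).
Qed.

Lemma leading_term (c : I -> R[i]) : (exists i, c i != 0) ->
  exists2 i0, c i0 != 0 & forall i, c i != 0 -> wt (u i0) <= wt (u i).
Proof.
move=> [i1 nz1]; exists [arg min_(i < i1 | c i != 0) wt (u i)]%O.
  by case: arg_minP.
by case: arg_minP => // i nzi min_i j /min_i.
Qed.

Lemma coeff_lead (c : I -> R[i]) i0 : \sum_i c i * (u i == u i0)%:R = c i0.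
Proof.
rewrite (bigD1 i0) //= eqxx mulr1 big1 ?addr0 // => i /negbTE.
by rewrite (inj_eq u_inj) => ->; rewrite mulr0.
Qed.

Lemma leads_free (c : I -> R[i]) : \sum_i c i *: G i = 0 -> forall i, c i = 0.
Proof.
move=> sum0 i; apply/eqP/negP => /negP nz_i.
have [i0 nz0 min0] := leading_term (ex_intro _ i nz_i).
have := leading_coeff min0 (lexx _).
by rewrite sum0 mcoeff0 coeff_lead => /esym/eqP; rewrite (negbTE nz0).
Qed.

(** Nothing cancels among the leading monomials, which are distinct. *)
Lemma initial_form_sum (c : I -> R[i]) i0 : c i0 != 0 ->
    (forall i, c i != 0 -> wt (u i0) <= wt (u i)) ->
  initial_form w (\sum_i c i *: G i) =
    \sum_(i | wt (u i) == wt (u i0)) c i *: 'X_[u i].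
Proof.
move=> nz0 min0.
set f := \sum_i _; have coef := leading_coeff min0; rewrite -/f in coef.
have low_support m : m \in msupp f -> wt (u i0) <= wt m.
  rewrite mcoeff_msupp; apply: contraR; rewrite -ltNge => lt_m.
  rewrite coef ?(ltW lt_m) // big1 // => i _.
  have [-> | nz_ci] := eqVneq (c i) 0; first by rewrite mul0r.
  case: eqP => [eq_um | _]; last by rewrite mulr0.
  by have := min0 i nz_ci; rewrite eq_um leNgt lt_m.
have wf : poly_weight w f = wt (u i0).
  apply: poly_weight_eq low_support.
  by rewrite mcoeff_msupp coef ?lexx // coeff_lead.
apply/mpolyP => m.
rewrite initial_form_coeff wf [RHS](big_morph _ (mcoeffD m) (mcoeff0 _ m)).
under eq_bigr => i _ do rewrite mcoeffZ mcoeffX.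
case: (eqVneq (wt m) (wt (u i0))) => [eq_m | neq_m].
  rewrite coef ?eq_m // [RHS]big_mkcond /=; apply: eq_bigr => i _.
  case: (eqVneq (u i) m) => [->|_]; rewrite ?mulr0 ?if_same //.
  by rewrite eq_m eqxx.
rewrite big1 // => i /eqP eq_i; case: eqP => [eq_um|]; last by rewrite mulr0.
by rewrite -eq_i eq_um eqxx in neq_m.
Qed.

End Family.

Lemma initial_form_leads c f u : leads f u -> c != 0 ->
  initial_form w (c *: f) = c *: 'X_[u].
Proof.
move=> lf nz_c.
have u_inj : injective (fun _ : unit => u) by move=> [] [].
have := @initial_form_sum unit (fun=> f) (fun=> u) u_inj (fun=> lf) (fun=> c) tt nz_c
  (fun _ _ => lexx _).
have sum_unit (E : unit -> poly) : \sum_i E i = E tt.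
  by rewrite (bigD1 tt) //= big1 ?addr0 // => -[].
by rewrite [in RHS]big_mkcond !sum_unit eqxx.
Qed.

End LeadingForm.

(** * The Khovanskii property *)

Section ColumnMonomials.
Variables (k n : nat).
Local Notation col := (column k n).

Definition column_monomial (T : 'I_k -> 'I_n) : 'X_{1..k * n} :=
  (\sum_(a < k) U_(mxvec_index a (T a)))%MM.

Definition tableau_monomial (t : seq col) : 'X_{1..k * n} :=
  (\sum_(T <- t) column_monomial T)%MM.

Lemma mxvec_index_inj (a b : 'I_k) (i j : 'I_n) :
  (mxvec_index a i == mxvec_index b j) = (a == b) && (i == j).
Proof. by rewrite (inj_eq (@cast_ord_inj _ _ _)) (inj_eq enum_rank_inj). Qed.

Lemma tableau_monomialE (t : seq col) a j :
  tableau_monomial t (mxvec_index a j) = count (fun T : col => T a == j) t.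
Proof.
rewrite /tableau_monomial mnm_sumE; elim: t => [|T t IHt]; first by rewrite big_nil.
rewrite big_cons IHt /=; congr (_ + _)%N.
rewrite /column_monomial mnm_sumE (bigD1 a) //= mnm1E mxvec_index_inj eqxx.
rewrite big1 ?addn0 // => b /negbTE neq_ba.
by rewrite mnm1E mxvec_index_inj neq_ba.
Qed.

Lemma exponent_tableau_monomial (t u : seq col) :
  tableau_monomial t = tableau_monomial u -> exponent t = exponent u.
Proof.
by move=> eq_tu; apply/matrixP => a j; rewrite !exponentE -!tableau_monomialE eq_tu.
Qed.

Lemma size_tableau_monomial (t u : seq col) : (0 < k)%N ->
  tableau_monomial t = tableau_monomial u -> size t = size u.
Proof.
move=> k_gt0 eq_tu; pose a := Ordinal k_gt0.
have sizeE (s : seq col) :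
    size s = (\sum_j tableau_monomial s (mxvec_index a j))%N.
  under eq_bigr => j _ do rewrite tableau_monomialE.
  elim: s => [|T s IHs] /=; first by rewrite big1.
  rewrite big_split /= -IHs (bigD1 (T a)) //= eqxx big1 // => j.
  by rewrite eq_sym => /negbTE->.
by rewrite !sizeE eq_tu.
Qed.

End ColumnMonomials.

Definition generic_matrix (R : realType) k n : 'M[{mpoly R[i][k * n]}]_(k, n) :=
  \matrix_(a, b) 'X_(mxvec_index a b).

Lemma plucker_form_minor (R : realType) k n (J : ksubset k n) :
  plucker_form R J = minor (generic_matrix R k n) (elt J).
Proof. by congr (\det _); apply/matrixP => a b; rewrite !mxE. Qed.

Section LeadingMinors.
Variables (R : realType) (k n : nat) (M : 'M[R]_(k, n)).
Local Notation X := (generic_matrix R k n).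
Local Notation wt := (monomial_weight (mxvec M)).

Lemma column_monomial_weight (T : 'I_k -> 'I_n) :
  wt (column_monomial T) = \sum_a M a (T a).
Proof.
rewrite /column_monomial (big_morph wt (monomial_weightD (mxvec M)) (id1 := 0)) /=.
  apply: eq_bigr => a _; rewrite /monomial_weight (bigD1 (mxvec_index a (T a))) //=.
  rewrite mnm1E eqxx mul1r mxvecE big1 ?addr0 // => v neq_v.
  by rewrite mnm1E eq_sym (negbTE neq_v) mul0r.
by rewrite /monomial_weight big1 // => v _; rewrite mnm0E mul0r.
Qed.

Lemma minor_monomials (T : 'I_k -> 'I_n) :
  minor X T = \sum_(s : 'S_k) (-1) ^+ s *: 'X_[column_monomial (fun a => T (s a))].
Proof.
rewrite /minor /determinant; apply: eq_bigr => s _.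
have -> : \prod_a (\matrix_(a, b) X a (T b)) a (s a) =
    'X_[column_monomial (fun a => T (s a))].
  rewrite (big_morph _ (@mpolyXD _ _) (mpolyX0 _ _)).
  by apply: eq_bigr => a _; rewrite !mxE.
by rewrite mulr_sign scaler_sign.
Qed.

Lemma leads_minor (T : 'I_k -> 'I_n) :
    (forall s : 'S_k, s != 1%g -> \sum_a M a (T a) < \sum_a M a (T (s a))) ->
  leads (mxvec M) (minor X T) (column_monomial T).
Proof.
move=> minT; rewrite /leads minor_monomials (bigD1 1%g) //= odd_perm1 scale1r.
have -> : column_monomial (fun a => T ((1%g : 'S_k) a)) = column_monomial T.
  by apply: eq_bigr => a _; rewrite perm1.
rewrite addrAC subrr add0r; elim/big_ind: _ => [|f g|s neq_s1].
- exact: heavier0.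
- exact: heavierD.
by apply/heavierZ/heavierX; rewrite !column_monomial_weight minT.
Qed.

Lemma leads_minors (t : seq (column k n)) :
    (forall T, T \in t -> leads (mxvec M) (minor X T) (column_monomial T)) ->
  leads (mxvec M) (minors X t) (tableau_monomial t).
Proof.
elim: t => [_ | T t IHt lead_t].
  by rewrite /minors /tableau_monomial !big_nil; apply: leads1.
rewrite /minors /tableau_monomial !big_cons; apply: leadsM.
  by apply: lead_t; rewrite mem_head.
by apply: IHt => T' T't; apply: lead_t; rewrite inE T't orbT.
Qed.

End LeadingMinors.

Lemma ordered_injective k n rk (T : 'I_k -> 'I_n) : ordered rk T -> injective T.
Proof.
move=> /orderedP ordT a b eqT.
by case: (ltngtP a b) => [/ordT|/ordT|/val_inj //]; rewrite eqT ltnn.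
Qed.

Lemma elt_inj k n (J : ksubset k n) : injective (elt J).
Proof. by move=> a b /enum_val_inj /cast_ord_inj. Qed.

Lemma injective_column_elt k n (T : 'I_k -> 'I_n) : injective T ->
  exists (J : ksubset k n) (s : 'S_k), forall a, T a = elt J (s a).
Proof.
move=> injT.
have cardJ : #|T @: [set: 'I_k]| == k by rewrite card_imset // cardsT card_ord.
pose J : ksubset k n := exist (fun J : {set 'I_n} => #|J| == k) _ cardJ.
have inJ a : T a \in val J by apply: imset_f; rewrite inE.
pose f a := cast_ord (eqP (valP J)) (enum_rank_in (inJ a) (T a)).
have fE a : elt J (f a) = T a by rewrite /elt /f cast_ordK enum_rankK_in.
have f_inj : injective f by move=> a b eq_f; apply: injT; rewrite -!fE eq_f.
by exists J, (perm f_inj) => a; rewrite permE fE.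
Qed.

Section Degeneration.
Variables (R : realType) (k n i : nat).
Hypotheses (k_gt0 : (0 < k)%N) (ltkn : (k < n)%N) (lt_i : (i < num_triples k n)%N).

Local Notation X := (generic_matrix R k n).
Local Notation M := (weight_mx R k n i).
Local Notation col := (column k n).
Let rk := row_pos k n (triple_at k n i).

Let kn : (0 < k < n)%N. Proof. by rewrite k_gt0. Qed.
Let valid_i : valid_triple k n (triple_at k n i). Proof. exact: triple_at_valid. Qed.

Lemma weight_mx_digits a b : M a b = (digit_weight n rk a b)%:R.
Proof. by rewrite mxE weight_funE ?ltn_ord // /digit_weight eqSS subSS subn1. Qed.

Lemma matching_weight_digits (J : ksubset k n) (s : 'S_k) :
  matching_weight M J s = (\sum_(a < k) digit_weight n rk a (elt J (s a)))%N%:R.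
Proof. by rewrite natr_sum; apply: eq_bigr => a _; rewrite weight_mx_digits. Qed.

Lemma weight_mx_generic : generic_weight M.
Proof.
move=> J; exists [arg min_(s < 1%g : 'S_k) matching_weight M J s]%O => t.
case: arg_minP => // s _ min_s neq_ts; rewrite lt_neqAle min_s // andbT.
apply: contra neq_ts; rewrite !matching_weight_digits eqr_nat => /eqP eq_st.
apply/eqP/esym; apply: digit_weight_inj eq_st; last exact: elt_inj.
- by move=> r j; apply: row_pos_le.
- by move=> r x y; apply: row_pos_inj.
Qed.

Lemma leads_ordered (T : 'I_k -> 'I_n) : ordered rk T ->
  leads (mxvec M) (minor X T) (column_monomial T).
Proof.
move=> ordT; apply: leads_minor => s neq_s1.
under eq_bigr => a _ do rewrite weight_mx_digits.
under [ltRHS]eq_bigr => a _ do rewrite weight_mx_digits.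
by rewrite -!natr_sum ltr_nat; apply: ordered_minimal => // r j; exact: row_pos_le.
Qed.

Let initial_forms (h : {mpoly R[i][k * n]}) :=
  exists J : ksubset k n, h = initial_form (mxvec M) (plucker_form R J).

Lemma subalgebra_column_monomial (T : 'I_k -> 'I_n) : ordered rk T ->
  subalgebra_gen initial_forms 'X_[column_monomial T].
Proof.
move=> ordT; have [J [s TE]] := injective_column_elt (ordered_injective ordT).
have eqJ : plucker_form R J = (-1) ^+ s *: minor X T.
  rewrite plucker_form_minor (eq_minor X TE) minor_perm scaler_sign -mulr_sign.
  by rewrite signrMK.
have sign_neq0 : (-1) ^+ s != 0 :> R[i] by rewrite signr_eq0.
have := initial_form_leads (leads_ordered ordT) sign_neq0; rewrite -eqJ => eq_in.
have -> : 'X_[column_monomial T] =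
    ((-1) ^+ s)%:MP * initial_form (mxvec M) (plucker_form R J) :> {mpoly R[i][k * n]}.
  by rewrite eq_in mul_mpolyC scalerA -expr2 sqrr_sign scale1r.
by apply: SubalgMul; [apply: SubalgConst | apply: SubalgGen; exists J].
Qed.

Lemma subalgebra_tableau_monomial (t : seq col) : all (fun T : col => ordered rk T) t ->
  subalgebra_gen initial_forms 'X_[tableau_monomial t].
Proof.
elim: t => [_ | T t IHt /= /andP[oT ot]].
  by rewrite /tableau_monomial big_nil mpolyX0 -[1]/(1%:MP); apply: SubalgConst.
rewrite /tableau_monomial big_cons mpolyXD; apply: SubalgMul; last exact: IHt.
exact: subalgebra_column_monomial.
Qed.

Lemma plucker_algebra_minors f : @plucker_algebra R k n f ->
  exists L : seq (R[i] * seq col), f = \sum_(x <- L) x.1 *: minors X x.2.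
Proof.
elim=> {f} [f [J ->] | c | f g _ [L1 ->] _ [L2 ->] | f g _ [L1 ->] _ [L2 ->]].
- exists [:: (1, [:: [ffun a => elt J a] : col])].
  rewrite big_seq1 scale1r /minors big_seq1 plucker_form_minor.
  by apply: eq_minor => a; rewrite ffunE.
- exists [:: (c, [::])]; rewrite big_seq1 /minors big_nil.
  by rewrite -mul_mpolyC mulr1.
- by exists (L1 ++ L2); rewrite big_cat.
exists [seq (x.1 * y.1, x.2 ++ y.2) | x <- L1, y <- L2].
rewrite big_allpairs_dep big_distrlr /=; apply: eq_bigr => x _; apply: eq_bigr => y _.
by rewrite minors_cat -scalerAl -scalerAr scalerA.
Qed.

(* One ordered tableau is chosen for each exponent matrix of degree below D; degrees
   are treated together because initial forms mix them. *)
Section Degree.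
Variable D : nat.
Local Notation expo d := (exponents d k n rk).
Local Notation index := {d : 'I_D & 'I_(size (expo d))}.

Lemma index_tableaux : exists tab : index -> seq col, forall x : index,
  [/\ size (tab x) = tag x, all (fun T : col => ordered rk T) (tab x) &
      nth 0 (expo (tag x)) (tagged x) = exponent (tab x)].
Proof.
suff H (x : index) : exists t : seq col,
    [/\ size t = tag x, all (fun T : col => ordered rk T) t &
        nth 0 (expo (tag x)) (tagged x) = exponent t].
  by have [tab tabP] := fin_all_exists H; exists tab.
have /exponentsP[t [sz_t ord_t ->]] := mem_nth 0 (ltn_ord (tagged x)).
by exists t.
Qed.

Variable tab : index -> seq col.
Hypothesis tabP : forall x : index,
  [/\ size (tab x) = tag x, all (fun T : col => ordered rk T) (tab x) &
      nth 0 (expo (tag x)) (tagged x) = exponent (tab x)].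

Lemma tableau_monomial_inj : injective (fun x => tableau_monomial (tab x)).
Proof.
move=> [d x] [e y] eq_m; have [sz_x _ ex] := tabP (Tagged _ x).
have [sz_y _ ey] := tabP (Tagged _ y).
have eq_de : d = e.
  apply: val_inj; rewrite /= -[val d]sz_x -[val e]sz_y.
  exact: size_tableau_monomial eq_m.
subst e; congr (Tagged _ _); apply: val_inj; apply/eqP.
have uniq_d : uniq (expo d) by apply: undup_uniq.
rewrite -(nth_uniq 0 (ltn_ord x) (ltn_ord y) uniq_d); apply/eqP.
exact: etrans ex (etrans (exponent_tableau_monomial eq_m) (esym ey)).
Qed.

Lemma leads_tableau x :
  leads (mxvec M) (minors X (tab x)) (tableau_monomial (tab x)).
Proof.
apply: leads_minors => T Tx; apply: leads_ordered.
by have [_ /allP/(_ T Tx)] := tabP x.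
Qed.

(** In each degree, the products indexed by the exponents are independent and lie in
    the span of the standard products, whose number they reach or exceed. *)
Lemma minors_span (t : seq col) : (size t < D)%N ->
  in_span (fun x => minors X (tab x)) (minors X t).
Proof.
move=> lt_t; pose d := Ordinal lt_t.
pose at_d (j : 'I_(size (expo d))) : index :=
  Tagged (fun d : 'I_D => 'I_(size (expo d))) j.
pose tab_d j := tab (at_d j).
apply: (in_span_trans (standard_span X (erefl (size t)))) => s.
apply: (in_span_trans (G := fun j => minors X (tab_d j))); last first.
  by move=> j; exact: (in_span_gen (fun x => minors X (tab x))).
apply: (independent_spans (H := fun s : {s : (size t).-tuple col | standard s} =>
  minors X (val s))).
- by move=> j; apply: standard_span; have [] := tabP (at_d j).
- apply: (@leads_free _ _ (mxvec M) _ _ (fun j => tableau_monomial (tab_d j))).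
    by move=> j j' /tableau_monomial_inj/eqP; rewrite eq_Tagged => /eqP.
  by move=> j; apply: leads_tableau.
rewrite card_ord; apply: leq_trans (card_standard _ ltkn) _.
exact: size_exponents_mono.
Qed.

End Degree.

Lemma initial_form_in f : @plucker_algebra R k n f ->
  subalgebra_gen initial_forms (initial_form (mxvec M) f).
Proof.
have in0 : subalgebra_gen initial_forms 0.
  by rewrite -(mpolyC0 _ R[i]); apply: SubalgConst.
move=> /plucker_algebra_minors[L ->].
pose D := (\max_(x <- L) size x.2).+1.
have [tab tabP] := index_tableaux D.
have : in_span (fun x => minors X (tab x)) (\sum_(x <- L) x.1 *: minors X x.2).
  rewrite big_seq; apply: in_span_sum => x xL; apply: in_spanZ.
  apply: (minors_span tabP); rewrite ltnS.
  exact: (@leq_bigmax_seq _ L xpredT (fun x => size x.2)).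
move=> [c ->].
have [/existsP nz | ] := boolP [exists x, c x != 0]; last first.
  rewrite negb_exists => /forallP c0; rewrite big1 ?initial_form0 // => x _.
  by have := c0 x; rewrite negbK => /eqP->; rewrite scale0r.
have [x0 nz0 min0] := leading_term (mxvec M) (fun x => tableau_monomial (tab x)) nz.
rewrite (initial_form_sum (tableau_monomial_inj tabP) (leads_tableau tabP) nz0 min0).
elim/big_ind: _ => [|f1 f2|x _] //; first exact: SubalgAdd.
rewrite -mul_mpolyC; apply: SubalgMul; first exact: SubalgConst.
by apply: subalgebra_tableau_monomial; have [] := tabP x.
Qed.

Lemma weight_mx_khovanskii : plucker_khovanskii M.
Proof.
split=> // g; split; last first.
  elim=> {g} [g [J ->] | c | f g _ IHf _ IHg | f g _ IHf _ IHg].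
  - by apply: SubalgGen; exists (plucker_form R J) => //; apply: SubalgGen; exists J.
  - exact: SubalgConst.
  - exact: SubalgAdd.
  exact: SubalgMul.
elim=> {g} [g [f Af ->] | c | f g _ IHf _ IHg | f g _ IHf _ IHg].
- exact: initial_form_in.
- exact: SubalgConst.
- exact: SubalgAdd.
exact: SubalgMul.
Qed.

End Degeneration.

Theorem mainTheorem4 (R : realType) (k n : nat) (hk : (1 <= k)%N)
    (hkn : (k < n)%N) (i : nat) (hi : (i < num_triples k n)%N) :
  gives_toric_degeneration (weight_mx R k n i) (block_matching_field R k n i).
Proof.
split=> //; first exact: weight_mx_generic.
exact: weight_mx_khovanskii.
Qed.
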